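(* Let $\sigma_1,\dots,\sigma_m$ be primitive, proper, positive endomorphisms of the free group $F_n$ on the positive generators $a_1,\dots,a_n$, and let $A_i\in M_n(\mathbb Z_{\ge0})$ be the matrix of the endomorphism of $H_1=\mathbb Z^n$ induced by $\sigma_i$ (with respect to the basis given by the generators). Suppose $A_1,\dots,A_m$ freely generate the semigroup they generate, i.e. distinct finite nonempty words in $A_1,\dots,A_m$ have distinct matrix products. Let $S$ be the collection of flow spaces admitting an expansion in which every $X_i$ is $W_n$ and every bonding map is one of $f_{\sigma_1},\dots,f_{\sigma_m}$ (admissible expansions, identified with their symbol sequences in $\{\sigma_1,\dots,\sigma_m\}$). Then two flow spaces in $S$ are flow equivalent if and only if they have admissible expansions whose symbol sequences are tail equivalent.
   Context: $W_n$: oriented wedge of $n$ circles labelled $a_1,\dots,a_n$. A positive endomorphism of $F_n$ maps the semigroup generated by $a_1,\dots,a_n$ into itself; for such $\sigma$, $f_\sigma\colon W_n\to W_n$ denotes a positive map (continuous surjection, wedge point to wedge point, orientation preserving on each circle, locally injective away from the wedge point) whose image of circle $a_j$ traverses in order the circles spelled by the positive word $\sigma(a_j)$. $\sigma$ is proper if there are letters $c,d$ with every $\sigma(a_j)=c\,v_j\,d$ for positive (possibly empty) words $v_j$; primitive if every $\sigma(a_j)$ contains every letter $a_1,\dots,a_n$. Flow space: compact metrizable space of dimension one with continuous $\mathbb R$-action without fixed points; flow equivalence: homeomorphism mapping orbits to orbits preserving flow orientation. Expansion of $\mathbb X$ about a point: oriented wedges $X_i$, positive maps $f_i\colon X_{i+1}\to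 X_i$, projections $p_i\colon\mathbb X\to X_i$ (continuous surjections, locally injective and orientation preserving along orbits, sending the point to the wedge point) with $p_n=f_n\circ\cdots\circ f_{m-1}\circ p_m$ and $x\mapsto(p_i(x))_i$ a homeomorphism onto $\varprojlim(X_i,f_i)$. Sequences $(s_i)$, $(t_i)$ are tail equivalent if there exist $k,l$ with $s_{k+j}=t_{l+j}$ for all $j\ge0$. *)

(* Defs.v *)
From HB Require Import structures.
From mathcomp Require Import all_boot all_order all_algebra.
From mathcomp Require Import all_classical all_reals all_analysis.
Set Implicit Arguments. Unset Strict Implicit. Unset Printing Implicit Defensive.
Import Order.TTheory GRing.Theory Num.Theory.
Import numFieldNormedType.Exports.
Local Open Scope classical_set_scope.
Local Open Scope ring_scope.

(* An endomorphism of F_n = <a_1..a_n> is determined by the images of the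
   generators; a positive one sends each a_j to a positive word, which we
   represent as a (nonempty) sequence of generator indices. *)
Definition endo (n : nat) := 'I_n -> seq 'I_n.

Definition positive_endo (n : nat) (s : endo n) : Prop :=
  forall j, s j <> [::].

Definition proper_endo (n : nat) (s : endo n) : Prop :=
  exists c d : 'I_n, forall j, exists v : seq 'I_n, s j = c :: rcons v d.

Definition primitive_endo (n : nat) (s : endo n) : Prop :=
  forall j k : 'I_n, k \in s j.

(* matrix of the induced endomorphism of H_1 = Z^n: column j = abelianization
   of s(a_j), i.e. entry (i,j) = number of occurrences of a_i in s(a_j) *)
Definition abel_mx (n : nat) (s : endo n) : 'M[int]_n :=
  \matrix_(i < n, j < n) (count_mem i (s j))%:Z.

Definition word_prod (n m : nat) (A : 'I_m -> 'M[int]_n) (w : seq 'I_m)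
  : 'M[int]_n := foldr (fun i M => A i *m M) 1%:M w.

Definition freely_generate (n m : nat) (A : 'I_m -> 'M[int]_n) : Prop :=
  forall w1 w2 : seq 'I_m, w1 <> [::] -> w2 <> [::] ->
    word_prod A w1 = word_prod A w2 -> w1 = w2.

Definition metrizable (R : realType) (X : topologicalType) : Prop :=
  exists d : X -> X -> R,
    (forall x y, 0 <= d x y) /\ (forall x y, d x y = 0 <-> x = y) /\
    (forall x y, d x y = d y x) /\ (forall x y z, d x z <= d x y + d y z) /\
    (forall U : set X, open U <->
       (forall x, U x -> exists e : R, 0 < e /\ [set y | d x y < e] `<=` U)).

Definition covdim_le (X : topologicalType) (k : nat) : Prop :=
  forall (p : nat) (U : 'I_p -> set X),
    (forall i, open (U i)) -> (forall x, exists i, U i x) ->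
    exists (q : nat) (V : 'I_q -> set X),
      (forall j, open (V j)) /\ (forall x, exists j, V j x) /\
      (forall j, exists i, V j `<=` U i) /\
      (forall (J : {set 'I_q}) (x : X), #|J| = k.+2 -> ~ (forall j, j \in J -> V j x)).

Definition dimension_one (X : topologicalType) : Prop :=
  covdim_le X 1 /\ ~ covdim_le X 0.

Definition is_flow (R : realType) (X : topologicalType) (phi : R -> X -> X) : Prop :=
  continuous (fun q : R * X => phi q.1 q.2) /\
  (forall x, phi 0 x = x) /\ (forall s t x, phi (s + t) x = phi s (phi t x)).

Definition flow_space (R : realType) (X : topologicalType) (phi : R -> X -> X) : Prop :=
  compact [set: X] /\ metrizable R X /\ dimension_one X /\ is_flow phi /\
  (forall x, exists t, phi t x <> x).

Definition orbit (R : realType) (X : Type) (phi : R -> X -> X) (x : X) : set X :=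
  [set y | exists t, y = phi t x].

Definition flow_equivalent (R : realType) (X Y : topologicalType)
  (phi : R -> X -> X) (psi : R -> Y -> Y) : Prop :=
  exists (h : X -> Y) (g : Y -> X),
    cancel h g /\ cancel g h /\ continuous h /\ continuous g /\
    (forall x, h @` orbit phi x = orbit psi (h x)) /\
    (forall x, exists tau : R -> R, (forall s t, s < t -> tau s < tau t) /\
        forall t, h (phi t x) = psi (tau t) (h x)).

(* circle a_j is the circle of radius j+1 centred at (j+1,0); all circles
   meet only at the wedge point (0,0); orientation = counterclockwise, and
   gam j : [0,1] -> circle j is the oriented parametrisation from the wedge
   point to itself. *)
Definition gam (R : realType) (n : nat) (j : 'I_n) (t : R) : R * R :=
  ((j.+1)%:R * (1 - cos (2 * pi * t)), (j.+1)%:R * sin (2 * pi * t)).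

Definition wpt (R : realType) : R * R := (0, 0).

Definition wedge (R : realType) (n : nat) : set (R * R) :=
  [set q | q = wpt R \/ exists (j : 'I_n) (t : R), q = gam j t].
Arguments wedge : clear implicits.
Arguments wpt : clear implicits.

Definition positive_map_for (R : realType) (n : nat) (s : endo n)
  (f : R * R -> R * R) : Prop :=
  {within wedge R n, continuous f} /\
  (forall q, wedge R n q -> wedge R n (f q)) /\
  (forall q, wedge R n q -> exists p, wedge R n p /\ f p = q) /\
  f (wpt R) = wpt R /\
  (* the image of circle a_j traverses, in order and positively, the circles
     spelled by s(a_j) (this encodes orientation preservation and local
     injectivity away from the wedge point) *)
  (forall j : 'I_n, exists tt : nat -> R,
     tt 0%N = 0 /\ tt (size (s j)) = 1 /\
     (forall k, (k < size (s j))%N -> tt k < tt k.+1) /\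
     (forall k, (k < size (s j))%N -> exists h : R -> R,
        h (tt k) = 0 /\ h (tt k.+1) = 1 /\
        (forall s1 s2, tt k <= s1 -> s1 < s2 -> s2 <= tt k.+1 -> h s1 < h s2) /\
        {within [set u | tt k <= u <= tt k.+1], continuous h} /\
        (forall u, tt k <= u <= tt k.+1 -> f (gam j u) = gam (nth j (s j) k) (h u)))).

Arguments positive_map_for : clear implicits.
Arguments positive_map_for R [n].

(* p is locally injective and orientation preserving along orbits *)
Definition along_orbits (R : realType) (n : nat) (X : Type) (phi : R -> X -> X)
  (p : X -> R * R) : Prop :=
  forall (x : X) (t : R),
    (exists e : R, 0 < e /\ forall s1 s2, t - e < s1 < t + e -> t - e < s2 < t + e ->
        p (phi s1 x) = p (phi s2 x) -> s1 = s2) /\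
    (exists (e : R) (j k : 'I_n) (th1 th2 : R -> R), 0 < e /\
       (forall u, t - e < u <= t -> 0 < th1 u <= 1 /\ p (phi u x) = gam j (th1 u)) /\
       (forall u1 u2, t - e < u1 -> u1 < u2 -> u2 <= t -> th1 u1 < th1 u2) /\
       (forall u, t <= u < t + e -> 0 <= th2 u < 1 /\ p (phi u x) = gam k (th2 u)) /\
       (forall u1 u2, t <= u1 -> u1 < u2 -> u2 < t + e -> th2 u1 < th2 u2)).

Definition admissible_expansion (R : realType) (n m : nat) (sigma : 'I_m -> endo n)
  (X : topologicalType) (phi : R -> X -> X) (sq : nat -> 'I_m) : Prop :=
  exists (x0 : X) (f : nat -> R * R -> R * R) (p : nat -> X -> R * R),
    (forall i, positive_map_for R (sigma (sq i)) (f i)) /\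
    (forall i, continuous (p i)) /\
    (forall i x, wedge R n (p i x)) /\
    (forall i q, wedge R n q -> exists x, p i x = q) /\
    (forall i, along_orbits n phi (p i)) /\
    (forall i, p i x0 = wpt R) /\
    (forall i x, p i x = f i (p i.+1 x)) /\
    (* x |-> (p_i x)_i is a homeomorphism onto the inverse limit *)
    (forall x y, (forall i, p i x = p i y) -> x = y) /\
    (forall y : nat -> R * R, (forall i, wedge R n (y i)) ->
       (forall i, y i = f i (y i.+1)) -> exists x, forall i, p i x = y i) /\
    (forall U : set X, open U -> forall x, U x ->
       exists (N : nat) (V : nat -> set (R * R)),
         (forall k, open (V k)) /\ (forall k, (k <= N)%N -> V k (p k x)) /\
         (forall x', (forall k, (k <= N)%N -> V k (p k x')) -> U x')).

Definition in_S (R : realType) (n m : nat) (sigma : 'I_m -> endo n)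
  (X : topologicalType) (phi : R -> X -> X) : Prop :=
  exists sq, admissible_expansion sigma phi sq.

Definition tail_equiv (T : Type) (s t : nat -> T) : Prop :=
  exists k l : nat, forall j : nat, s (k + j)%N = t (l + j)%N.

(* Main.v *)
(* If h : X -> Y is a flow equivalence, every expansion p_i of Y pulls back to
   the expansion p_i o h of X with the same symbols (the time change of h may
   jump only by periods of an orbit, which does not affect p_i o h), so X and Y
   even share a symbol sequence.

   Conversely, drop finitely many levels so that X and Y have the same symbols,
   with bonding maps f_i and f'_i that may only differ by parametrisation.
   Starting with the identity, lift rescalings of the circles level by level to
   g_i with f'_i g_(i+1) = g_i f_i; they converge to a homeomorphism h with
   q_i h = g_i p_i.  It maps orbits to orbits because, the substitutions being
   proper, a point of the inverse limit determines the germs of all positive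
   lines through it: the outgoing circle at level i is the first letter of
   sigma_i when p_(i+1) is at the wedge point, and is read off p_(i+1)
   otherwise. *)

Require Import Defs.
From HB Require Import structures.
From mathcomp Require Import all_boot all_order all_algebra.
From mathcomp Require Import all_classical all_reals all_analysis.
From mathcomp Require Import zify ring lra.
Set Implicit Arguments.
Unset Strict Implicit.
Unset Printing Implicit Defensive.
Import Order.TTheory GRing.Theory Num.Theory.
Import numFieldNormedType.Exports.
Local Open Scope classical_set_scope.
Local Open Scope ring_scope.

(** * The circles of the wedge *)

(** The properties of the circles used below, kept abstract so that they apply both to [gam] and to
    the circles run backwards; results on outgoing germs then give those on incoming ones. Taking
    [t] interior and [u] in the closed interval also keeps interior points away from [o]. *)
Definition bouquet (R : realType) (n : nat) (T : topologicalType)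
    (gm : 'I_n -> R -> T) (o : T) : Prop :=
  [/\ forall a, gm a 0 = o, forall a, gm a 1 = o, forall a, continuous (gm a) &
      forall a b t u, 0 < t < 1 -> 0 <= u <= 1 -> gm a t = gm b u ->
        a = b /\ t = u].

(** Connectedness of [I]: the part of [I] in [K1] is closed, and open as the complement of [K2].
    Closed sets are convenient because the arcs used later are compact. *)
Lemma interval_clopen (R : realType) (I K1 K2 : set R) :
  is_interval I -> closed K1 -> closed K2 -> I `<=` K1 `|` K2 ->
  (forall u, I u -> K1 u -> ~ K2 u) -> (exists2 u, I u & K1 u) -> I `<=` K1.
Proof.
move=> /connected_intervalP cI cK1 cK2 cov dis [u0 Iu0 Ku0].
suff <- : I `&` K1 = I by move=> u [].
apply: cI; first by exists u0.
- exists (~` K2); first exact: closed_openC.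
  apply/seteqP; split=> u [Iu Ku]; split=> //; first exact: dis.
  by case: (cov _ Iu).
- by exists K1.
Qed.

Section Circles.
Variables (R : realType) (n : nat).
Implicit Types (j k : 'I_n) (t u : R).

Lemma gam_periodic j t (z : int) : gam j (t + z%:~R) = gam j t.
Proof.
have Pn (m : nat) (s : R) : gam j (s + m%:R) = gam j s.
  rewrite /gam; have -> : 2 * pi * (s + m%:R) = 2 * pi * s + (pi *+ 2) *+ m :> R.
    by rewrite -mulr_natr -[pi *+ 2]mulr_natr; ring.
  by rewrite (periodicn (@cosD2pi R)) (periodicn (@sinD2pi R)).
case: z => m; first by rewrite -pmulrn Pn.
by rewrite NegzE mulrNz -(Pn m.+1 (t - m.+1%:~R)) -pmulrn subrK.
Qed.

Lemma gam0 j : gam j 0 = wpt R.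
Proof. by rewrite /gam mulr0 cos0 sin0 subrr !mulr0. Qed.

Lemma gam1 j : gam j 1 = wpt R.
Proof. by rewrite -[1]add0r (gam_periodic j 0 1) gam0. Qed.

Lemma continuous_gam j : continuous (@gam R n j).
Proof.
have cc (f : R -> R) : continuous f -> continuous (fun t : R => f (2 * pi * t)).
  move=> cf t; apply: (@continuous_comp _ _ _ (fun t : R => 2 * pi * t) f).
    exact: mulrl_continuous.
  exact: cf.
move=> t; rewrite /continuous_at; apply: (@cvg_pair _ _ _ _ (nbhs _) (nbhs _)).
- apply: cvgM; first exact: cvg_cst.
  by apply: cvgB; [exact: cvg_cst|apply: cc; exact: continuous_cos].
- apply: cvgM; first exact: cvg_cst.
  by apply: cc; exact: continuous_sin.
Qed.

(* half-angle form: the tangent of the angle at the wedge point recovers t,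
   and then the distance recovers the radius *)
Lemma gam_half j t : gam j t =
  (2 * j.+1%:R * sin (pi * t) ^+ 2, 2 * j.+1%:R * (sin (pi * t) * cos (pi * t))).
Proof.
rewrite /gam; have -> : 2 * pi * t = pi * t + pi * t by ring.
have := cos2Dsin2 (pi * t); rewrite cosD sinD => h; congr pair; last by ring.
by rewrite -[X in X - _]h; ring.
Qed.

Lemma gam_inj j k t u : 0 < t < 1 -> 0 <= u <= 1 -> gam j t = gam k u ->
  j = k /\ t = u.
Proof.
move=> /andP[t0 t1] /andP[u0 u1]; rewrite !gam_half => -[e1 e2].
have pi0 := pi_gt0 R.
have s0 : 0 < sin (pi * t).
  by apply: sin_gt0_pi; rewrite mulr_gt0//= gtr_pMr.
have s'0 : 0 <= sin (pi * u).
  by apply: sin_ge0_pi; rewrite (mulr_ge0 (ltW pi0) u0)/= ger_pMr.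
have j0 : 0 < j.+1%:R :> R by rewrite ltr0n.
have k0 : 0 < k.+1%:R :> R by rewrite ltr0n.
set a := sin (pi * t) in e1 e2 s0 *; set b := sin (pi * u) in e1 e2 s'0 *.
set c := cos (pi * t) in e2 *; set d := cos (pi * u) in e2 *.
have b0 : 0 < b.
  rewrite lt_neqAle s'0 andbT; apply/negP => /eqP b0.
  have := mulr_gt0 (mulr_gt0 (ltr0n R 2) j0) (exprn_gt0 2 s0).
  by rewrite e1 -b0 expr0n/= mulr0 ltxx.
(* Equal points have equal slope, so the cotangents of [pi * t] and [pi * u] agree; cleared of
   denominators this is the vanishing of [sin (pi * (t - u))]. *)
have ad : a * d - c * b = 0.
  have : 2 * j.+1%:R * a ^+ 2 * (b * d) = 2 * j.+1%:R * (a * c) * b ^+ 2.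
    by rewrite e1 e2; ring.
  move=> h; have : 2 * j.+1%:R * a * b * (a * d - c * b) = 0.
    by rewrite mulrBr; apply/eqP; rewrite subr_eq0; apply/eqP; move: h; lra.
  by move/eqP; rewrite mulf_eq0 gt_eqF ?mulr_gt0 ?ltr0n//= => /eqP.
have tu : t = u.
  move: ad; rewrite -sinB -mulrBr => h.
  apply/eqP; case: (ltgtP t u) => // tu; exfalso.
  - have : 0 < sin (pi * (u - t)).
      apply: sin_gt0_pi; rewrite mulr_gt0// ?subr_gt0//= gtr_pMr//; lra.
    by rewrite -opprB mulrN sinN h oppr0 ltxx.
  - have : 0 < sin (pi * (t - u)).
      apply: sin_gt0_pi; rewrite mulr_gt0// ?subr_gt0//= gtr_pMr//; lra.
    by rewrite h ltxx.
split=> //; apply/val_inj/eq_add_S; apply/eqP; rewrite -(eqr_nat R); apply/eqP.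
have ab : a = b by rewrite /a /b tu.
move: e1; rewrite ab; have := exprn_gt0 2 b0; set B := b ^+ 2 => B0 e1.
have : (j.+1%:R - k.+1%:R) * B = 0 by lra.
by move/eqP; rewrite mulf_eq0 (gt_eqF B0) orbF subr_eq0 => /eqP.
Qed.

Lemma gam_bouquet : bouquet (@gam R n) (wpt R).
Proof.
by split; [exact: gam0|exact: gam1|exact: continuous_gam|exact: gam_inj].
Qed.

Lemma gam_rev_bouquet : bouquet (fun j t => @gam R n j (1 - t)) (wpt R).
Proof.
split=> [a|a|a|a b t u t01 u01 h].
- by rewrite subr0 gam1.
- by rewrite subrr gam0.
- move=> t; apply: (@continuous_comp _ _ _ (fun t : R => 1 - t)).
    by apply: cvgB; [exact: cvg_cst|exact: cvg_id].
  exact: continuous_gam.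
- have [||-> tu] := gam_inj _ _ h; [lra|lra|].
  by split=> //; lra.
Qed.

Lemma wedge_gam j t : wedge R n (gam j t).
Proof. by right; exists j, t. Qed.

(** The index is there to give the wedge point a circle; other parameters are reduced modulo 1 by
    the floor. *)
Lemma wedgeP q : 'I_n -> wedge R n q ->
  exists (j : 'I_n) (t : R), 0 <= t <= 1 /\ q = gam j t.
Proof.
move=> j0 [->|[j [t ->]]].
  by exists j0, 0; rewrite gam0 lexx ler01.
exists j, (t - (Num.floor t)%:~R); split.
  have := floor_le t; have := floorD1_gt t.
  rewrite intrD; lra.
by rewrite -[X in gam j X = _](subrK (Num.floor t)%:~R) gam_periodic.
Qed.

Lemma plane_hausdorff : hausdorff_space (R * R)%type.
Proof. exact: (@norm_hausdorff _ (R * R)%type). Qed.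

End Circles.

(** * Germs of positive lines *)

Lemma closed_preimage (Z T : topologicalType) (f : Z -> T) (K : set T) :
  continuous f -> closed K -> closed (f @^-1` K).
Proof. by move=> /continuous_closedP; apply. Qed.

Section Germs.
Variables (R : realType) (n : nat) (T : topologicalType).
Variables (gm : 'I_n -> R -> T) (o : T).
Hypothesis hT : hausdorff_space T.
Hypothesis gB : bouquet gm o.
Implicit Types (a : 'I_n) (u v x y z e b : R) (C D : R -> T) (th : R -> R) (F : T -> T).

(** The traversal clause of [positive_map_for] on abstract circles and with an explicit word, so
    that it can be applied to reversed words on reversed circles. *)
Definition pieces (w : seq 'I_n) F a (tt : nat -> R) : Prop :=
  tt 0%N = 0 /\ tt (size w) = 1 /\
  (forall k, (k < size w)%N -> tt k < tt k.+1) /\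
  (forall k, (k < size w)%N -> exists h : R -> R,
     h (tt k) = 0 /\ h (tt k.+1) = 1 /\
     (forall s1 s2 : R, tt k <= s1 -> s1 < s2 -> s2 <= tt k.+1 -> h s1 < h s2) /\
     {within [set u | tt k <= u <= tt k.+1], continuous h} /\
     (forall u, tt k <= u <= tt k.+1 -> F (gm a u) = gm (nth a w k) (h u))).

(** The forward half of [along_orbits] at time 0. No continuity of [th] is assumed; it has to be
    drawn from that of [C]. *)
Definition right_germ C e a th : Prop :=
  [/\ 0 < e, forall u, 0 <= u < e -> 0 <= th u < 1 /\ C u = gm a (th u) &
      forall u1 u2 : R, 0 <= u1 -> u1 < u2 -> u2 < e -> th u1 < th u2].

Lemma bouquet_inj a a' t u : 0 <= t < 1 -> 0 <= u < 1 -> gm a t = gm a' u ->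
  (a = a' /\ t = u) \/ (t = 0 /\ u = 0).
Proof.
case: gB => _ _ _ inj /andP[t0 t1] /andP[u0 u1] h.
have [t_0|tn0] := eqVneq t 0; last first.
  have t_gt0 : 0 < t by rewrite lt_neqAle eq_sym tn0.
  by left; apply: inj h; lra.
have [u_0|un0] := eqVneq u 0; first by right.
have u_gt0 : 0 < u by rewrite lt_neqAle eq_sym un0.
by left; have [||-> ->] := inj a' a u t _ _ (esym h); [lra|lra|].
Qed.

Lemma bouquet_inj1 a t u : 0 <= t < 1 -> 0 <= u < 1 -> gm a t = gm a u -> t = u.
Proof. by move=> t01 u01 /(bouquet_inj t01 u01)[[]|[-> ->]]. Qed.

Lemma closed_arc a x y : closed (gm a @` [set u | x <= u <= y]).
Proof.
apply: compact_closed => //.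
apply: continuous_compact; last by rewrite -set_itvcc; exact: segment_compact.
by apply: continuous_subspaceT => u; case: gB => _ _ + _; apply.
Qed.

(** If [v] were skipped, the times with [th u <= v] and those with [v <= th u] would be disjoint
    preimages of two closed arcs covering [[0, b]], against connectedness. *)
Lemma right_germ_surj C e a th (b v : R) : continuous C -> right_germ C e a th ->
  0 <= b < e -> th 0 <= v <= th b -> exists2 u, 0 <= u <= b & th u = v.
Proof.
move=> cC [e0 gC mC] /andP[b0 be] /andP[v0 vb]; apply: contrapT => nv.
have inb u : 0 <= u <= b -> 0 <= u < e by move=> /andP[-> /le_lt_trans]; apply.
have mono (u1 u2 : R) : 0 <= u1 -> u1 <= u2 -> u2 < e -> th u1 <= th u2.
  move=> u10; rewrite le_eqVlt => /orP[/eqP-> //|u12 u2e].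
  by rewrite ltW// mC.
have th01 u : 0 <= u <= b -> 0 <= th u < 1 by move=> /inb/gC[].
have v01 : 0 <= v < 1.
  by have := th01 0 ltac:(lra); have := th01 b ltac:(lra); lra.
have key : [set u | 0 <= u <= b] `<=` C @^-1` (gm a @` [set u | th 0 <= u <= v]).
  apply: (@interval_clopen _ _ _ (C @^-1` (gm a @` [set u | v <= u <= th b]))).
  - by move=> x y /= ? ? z ?; lra.
  - by apply: closed_preimage => //; exact: closed_arc.
  - by apply: closed_preimage => //; exact: closed_arc.
  - move=> u /= uI; have [_ Cu] := gC u (inb u uI); move/andP: uI => [u0 ub].
    have := mono 0 u (lexx _) u0 (le_lt_trans ub be).
    have := mono u b u0 ub be.
    by move=> ? ?; case: (leP (th u) v) => ?; [left|right]; exists (th u) => //=; lra.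
  - move=> u /= uI [x /= xI xu] [y /= yI yu]; apply: nv; exists u => //.
    have [thu Cu] := gC u (inb u uI).
    have thb := th01 b ltac:(lra).
    have th0 := th01 0 ltac:(lra).
    have xth : x = th u by apply: (@bouquet_inj1 a) => //; [lra|rewrite -Cu].
    have yth : y = th u by apply: (@bouquet_inj1 a) => //; [lra|rewrite -Cu].
    lra.
  - exists 0; first by rewrite /= lexx.
    rewrite /preimage /=; have [_ ->] := gC 0 (inb 0 (introT andP (conj (lexx 0) b0))).
    by exists (th 0) => //=; rewrite lexx.
have [x /= xI] : (C @^-1` (gm a @` [set u | th 0 <= u <= v])) b by apply: key => /=; lra.
have [thb ->] := gC b (introT andP (conj b0 be)).
have th0 := th01 0 ltac:(lra).
move=> /bouquet_inj1 xb; apply: nv; exists b; first by rewrite b0 lexx.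
have : x = th b by apply: xb => //; lra.
lra.
Qed.

Lemma right_germ_small C e a th (v : R) : continuous C -> right_germ C e a th ->
  th 0 < v -> exists2 u, 0 < u < e & th u < v.
Proof.
move=> cC gC v0; have [e0 _ mC] := gC.
have m0 : th 0 < th (e / 2) by apply: mC; lra.
have [v2|v2] := ltP (th (e / 2)) v.
  by exists (e / 2) => //; lra.
have [u /andP[u0 ue] thu] := @right_germ_surj C e a th (e / 2) ((th 0 + v) / 2) cC gC
   ltac:(lra) ltac:(lra).
exists u; last lra.
suff : u != 0 by move=> /eqP u1; lra.
by apply/eqP => u1; move: thu; rewrite u1; lra.
Qed.

(** * Germs under a single bonding map *)

Section OneMap.
Variables (F : T -> T) (w : endo n).
Hypothesis Fo : F o = o.
Hypothesis wF : forall a, exists tt, pieces (w a) F a tt.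
Hypothesis wc : exists c, forall a, exists s, w a = c :: s.

Lemma pieces_mono s a tt : pieces s F a tt ->
  forall k l, (k <= l <= size s)%N -> tt k <= tt l.
Proof.
move=> [_ [_ [m _]]] k; elim=> [|l ih] /andP[kl ls].
  by move: kl; rewrite leqn0 => /eqP ->.
move: kl; rewrite leq_eqVlt => /orP[/eqP -> //|kl].
by apply: (le_trans (ih _)); [rewrite -ltnS kl ltnW|exact/ltW/m].
Qed.

Lemma pieces_bounds s a tt : pieces s F a tt ->
  forall k, (k <= size s)%N -> 0 <= tt k <= 1.
Proof.
move=> P k ks; have [<- [<- _]] := P.
by rewrite !(pieces_mono P)// ?ks ?leqnn.
Qed.

Lemma pieces_locate s a tt x : pieces s F a tt -> 0 <= x < 1 ->
  exists2 k, (k < size s)%N & tt k <= x < tt k.+1.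
Proof.
move=> P /andP[x0 x1]; have [t0 [t1 _]] := P.
have : exists k, x < tt k by exists (size s); rewrite t1.
move=> ex; case: (ex_minnP ex) => -[|k] xk mk.
  by move: xk; rewrite t0 ltNge x0.
exists k; first by apply: mk; rewrite t1.
by rewrite xk andbT leNgt; apply/negP => /mk; rewrite ltnn.
Qed.

(** Just after time 0 the upper line is strictly inside piece [k], so its image is strictly inside
    the circle of letter [k], and an interior point determines its circle. *)
Lemma next_letter a tt C e th D e' a' th' k : pieces (w a) F a tt ->
  continuous C -> right_germ C e a th -> right_germ D e' a' th' ->
  (forall u, D u = F (C u)) -> (k < size (w a))%N -> tt k <= th 0 < tt k.+1 ->
  a' = nth a (w a) k.
Proof.
move=> P cC gC [e'0 gD _] DC ks /andP[k0 k1].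
have [u0 /andP[u00 u0e] u0k] := right_germ_small cC gC k1.
have [_ gC1 mC] := gC; pose u := Num.min u0 (e' / 2).
have uu0 : u <= u0 by rewrite /u ge_min lexx.
have ue' : u <= e' / 2 by rewrite /u ge_min lexx orbT.
have u_gt0 : 0 < u by rewrite /u lt_min u00 divr_gt0.
have thu0 : th 0 < th u by apply: mC => //; lra.
have thu1 : th u < tt k.+1.
  move: uu0; rewrite le_eqVlt => /orP[/eqP -> //|uu0].
  by apply: lt_trans u0k; apply: mC => //; lra.
have [_ [_ [_ /(_ k ks)[h [h0 [h1 [hm [_ hF]]]]]]]] := P.
have h01 : 0 < h (th u) < 1 by rewrite -h0 -h1 !hm//; lra.
have [_ Cu] := gC1 u ltac:(lra); have [thu' Du] := gD u ltac:(lra).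
move: Du; rewrite DC Cu hF; last lra.
by case: gB => _ _ _ inj /inj[//||->]//; lra.
Qed.

(** Away from [o] the lower point itself gives its circle. At [o] the letter is read one level up:
    from the common position in a circle, or, if the upper point is [o] as well, from the first
    letter shared by all words. *)
Lemma germ_agree C D C' D' e1 a1 t1 e2 a2 t2 e1' a1' t1' e2' a2' t2' :
  continuous C -> continuous C' ->
  right_germ C e1 a1 t1 -> right_germ D e2 a2 t2 ->
  right_germ C' e1' a1' t1' -> right_germ D' e2' a2' t2' ->
  (forall u, D u = F (C u)) -> (forall u, D' u = F (C' u)) -> C 0 = C' 0 ->
  a2 = a2' /\ t2 0 = t2' 0.
Proof.
move=> cC cC' gC gD gC' gD' DC DC' CC0.
have at0 C0 e a t : right_germ C0 e a t -> 0 <= t 0 < 1 /\ C0 0 = gm a (t 0).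
  by move=> [e0 g _]; apply: g; rewrite lexx e0.
have DD0 : D 0 = D' 0 by rewrite DC DC' CC0.
have [[+ C0] [+ C0']] := (at0 _ _ _ _ gC, at0 _ _ _ _ gC').
have [[+ D0] [+ D0']] := (at0 _ _ _ _ gD, at0 _ _ _ _ gD').
move: DD0 CC0; rewrite D0 D0' C0 C0' => DD0 CC0 d0 d0' c0 c0'.
have [//|[t20 t20']] := bouquet_inj d0 d0' DD0; split; last by rewrite t20 t20'.
have [[aa tt]|[t10 t10']] := bouquet_inj c0 c0' CC0.
  move: gC' {CC0 C0' c0'}; rewrite -aa => gC'.
  have [s P] := wF a1; have [k ks /andP[k0 k1]] := pieces_locate P c0.
  rewrite (next_letter P cC gC gD DC ks); last by rewrite k0.
  by rewrite (next_letter P cC' gC' gD' DC' ks)// -tt k0.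
(* Both upper lines start at [o], hence in piece 0, whose letter is [c] whichever circle they
   enter. *)
have [c wac] := wc.
have [s P] := wF a1; have [s' P'] := wF a1'.
have [[v wv] [v' wv']] := (wac a1, wac a1').
have [[s0 [_ [sm _]]] [s0' [_ [sm' _]]]] := (P, P').
rewrite (@next_letter _ _ _ _ _ _ _ _ _ 0%N P cC gC gD DC) ?wv//; last first.
  by rewrite t10 s0 lexx -s0 sm// wv.
rewrite (@next_letter _ _ _ _ _ _ _ _ _ 0%N P' cC' gC' gD' DC') ?wv'//.
by rewrite t10' s0' lexx -s0' sm'// wv'.
Qed.

(** The ends of a piece are mapped to [o], so a line whose image avoids [o] cannot leave the piece.
    The closed arc of piece [k] and the closed rest of the bouquet separate the times in
    [(0, b]]. *)
Lemma stay_in_piece a tt C e th b k : pieces (w a) F a tt -> continuous C ->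
  right_germ C e a th -> (k < size (w a))%N -> tt k <= th 0 < tt k.+1 ->
  (forall u, exists a' x, 0 <= x <= 1 /\ C u = gm a' x) ->
  (forall u, 0 < u <= b -> F (C u) <> o) ->
  forall u, 0 < u <= b -> exists2 x, tt k < x < tt k.+1 & C u = gm a x.
Proof.
move=> P cC gC ks /andP[k0 k1] covC avoid u uI.
have [g0 g1 gc inj] := gB.
have [_ [_ [_ /(_ k ks)[h [h0 [h1 [hm [_ hF]]]]]]]] := P.
have kk1 : tt k < tt k.+1 by have [_ [_ [+ _]]] := P; apply.
have b0 := pieces_bounds P (ltnW ks); have b1 := pieces_bounds P ks.
have strict v x : 0 < v <= b -> tt k <= x <= tt k.+1 -> C v = gm a x -> tt k < x < tt k.+1.
  move=> vI /andP[x0 x1] Cv; have FC := avoid v vI; rewrite !lt_neqAle x0 x1 !andbT.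
  apply/andP; split; apply/eqP => xE; apply: FC; rewrite Cv.
    by rewrite -xE hF ?lexx ?ltW// h0 g0.
  by rewrite xE hF ?lexx ?andbT ?ltW// h1 g1.
suff : [set u | 0 < u <= b] `<=` C @^-1` (gm a @` [set u | tt k <= u <= tt k.+1]).
  by move=> /(_ u uI)[x /= xI /esym Cu]; exists x => //; exact: strict Cu.
pose rest : set T := \bigcup_(a' in [set: 'I_n])
     [set q | a' <> a /\ (gm a' @` [set u | 0 <= u <= 1]) q].
pose K2 := (gm a @` [set u | 0 <= u <= tt k]) `|`
  ((gm a @` [set u | tt k.+1 <= u <= 1]) `|` rest).
apply: (@interval_clopen _ _ _ (C @^-1` K2)).
- by move=> x y /= ? ? z ?; lra.
- by apply: closed_preimage => //; exact: closed_arc.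
- apply: closed_preimage => //; apply: closedU; first exact: closed_arc.
  apply: closedU; first exact: closed_arc.
  apply: closed_bigcup => [|a' _]; first exact: finite_finset.
  have [->|/eqP na] := eqVneq a' a.
    have -> : [set q | a <> a /\ (gm a @` [set u | 0 <= u <= 1]) q] = set0.
      by apply/seteqP; split=> q // -[].
    exact: closed0.
  have -> : [set q | a' <> a /\ (gm a' @` [set u | 0 <= u <= 1]) q] =
      gm a' @` [set u | 0 <= u <= 1] by apply/seteqP; split=> q // -[].
  exact: closed_arc.
- move=> v vI; have [a' [x [x01 Cv]]] := covC v.
  rewrite /preimage /= Cv; have [aa|/eqP na] := eqVneq a' a; last first.
    by right; right; right; exists a' => //; split=> //; exists x.
  rewrite aa; have [xk|xk] := leP x (tt k).
    by right; left; exists x => //=; lra.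
  have [xk1|xk1] := leP x (tt k.+1); first by left; exists x => //=; lra.
  by right; right; left; exists x => //=; lra.
- move=> v vI [x /= xI /esym Cv]; have xI' := strict v x vI xI Cv.
  have x01 : 0 < x < 1 by lra.
  rewrite /preimage /= Cv => -[[y /= yI /esym]|[[y /= yI /esym]|[a' _ [na [y /= yI /esym]]]]].
  + by move=> /inj[||_]; lra.
  + by move=> /inj[||_]; lra.
  + by move=> /inj[||/esym]//; lra.
- have [u0 /andP[u00 u0e] u0k] := right_germ_small cC gC k1.
  have [_ gC1 mC] := gC; pose v := Num.min u0 b.
  have vu0 : v <= u0 by rewrite /v ge_min lexx.
  have vb : v <= b by rewrite /v ge_min lexx orbT.
  have v_gt0 : 0 < v by rewrite /v lt_min u00; lra.
  exists v; first by rewrite /= v_gt0 vb.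
  have [_ Cv] := gC1 v ltac:(lra); exists (th v) => //=.
  have := mC 0 v (lexx _) v_gt0 ltac:(lra).
  have : th v <= th u0.
    by move: vu0; rewrite le_eqVlt => /orP[/eqP -> //|vu0]; rewrite ltW// mC// ltW.
  lra.
Qed.

End OneMap.

(* Two lines leaving the same point of the inverse limit: properness makes
   the outgoing circle at each level a function of the point, and as the
   level-0 image does not meet o again, at all higher levels both lines stay
   inside one arc, on which the bonding map is injective. *)
Lemma right_germ_unique (F : nat -> T -> T) (w : nat -> endo n) (C C' : nat -> R -> T) :
  (forall i, F i o = o) ->
  (forall i a, exists tt, pieces (w i a) (F i) a tt) ->
  (forall i, exists c, forall a, exists s, w i a = c :: s) ->
  (forall i, continuous (C i)) -> (forall i, continuous (C' i)) ->
  (forall i u, C i u = F i (C i.+1 u)) -> (forall i u, C' i u = F i (C' i.+1 u)) ->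
  (forall i u, exists a x, 0 <= x <= 1 /\ C i u = gm a x) ->
  (forall i u, exists a x, 0 <= x <= 1 /\ C' i u = gm a x) ->
  (forall i, exists e a th, right_germ (C i) e a th) ->
  (forall i, exists e a th, right_germ (C' i) e a th) ->
  (forall i, C i 0 = C' i 0) ->
  exists e rho, [/\ 0 < e, rho 0 = 0,
    forall u1 u2 : R, 0 <= u1 -> u1 < u2 -> u2 <= e -> rho u1 < rho u2 &
    forall u, 0 <= u <= e -> forall i, C i u = C' i (rho u)].
Proof.
move=> Fo wF wc cC cC' CF CF' covC covC' gC gC' CC0.
have agree i e a t e' a' t' : right_germ (C i) e a t -> right_germ (C' i) e' a' t' ->
    a = a' /\ t 0 = t' 0.
  move=> g g'; have [e1 [a1 [t1 g1]]] := gC i.+1; have [e1' [a1' [t1' g1']]] := gC' i.+1.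
  exact: (germ_agree (wF i) (wc i) (cC i.+1) (cC' i.+1) g1 g g1' g' (CF i) (CF' i)).
have [e [a [t g]]] := gC 0%N; have [e' [a' [t' g']]] := gC' 0%N.
have [aa tt0] := agree _ _ _ _ _ _ _ g g'; move: g'; rewrite -{}aa {a'} => g'.
have [e0 g1 mg] := g; have [e'0 g1' mg'] := g'.
(* Shorten the time so that every level-0 position of [C] up to [eps] is reached by [C'] before
   [e' / 2]. *)
have [eps [eps0 epse] tb] : exists2 eps, 0 < eps /\ eps < e & t eps <= t' (e' / 2).
  have [tb|tb] := leP (t (e / 2)) (t' (e' / 2)); first by exists (e / 2) => //; split; lra.
  have m0 : t' 0 < t' (e' / 2) by apply: mg'; lra.
  have [u /andP[u0 ue] tu] := @right_germ_surj (C 0%N) e a t (e / 2) (t' (e' / 2))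
      (cC 0%N) g ltac:(lra) ltac:(lra).
  exists u; last by rewrite tu.
  have : u != 0 by apply/eqP => u1; move: tu; rewrite u1; lra.
  move=> un0; have : 0 < u by rewrite lt_neqAle eq_sym un0 u0.
  by move=> ?; split; lra.
have mono (u1 u2 : R) : 0 <= u1 -> u1 <= u2 -> u2 < e -> t u1 <= t u2.
  by move=> u10; rewrite le_eqVlt => /orP[/eqP -> //|? ?]; rewrite ltW// mg.
have mono' (u1 u2 : R) : 0 <= u1 -> u1 <= u2 -> u2 < e' -> t' u1 <= t' u2.
  by move=> u10; rewrite le_eqVlt => /orP[/eqP -> //|? ?]; rewrite ltW// mg'.
(* The time change is read off at level 0 alone, by matching positions on the common circle; the
   induction below shows that it serves all levels. *)
have /choice[rho rhoP] u : exists v, 0 <= u <= eps -> 0 <= v <= e' / 2 /\ t' v = t u.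
  have [/andP[u0 ue]|] := boolP (0 <= u <= eps); last by exists 0.
  have [|v vI tv] := @right_germ_surj (C' 0%N) e' a t' (e' / 2) (t u) (cC' 0%N) g' ltac:(lra).
    by rewrite -tt0 (mono 0 u)//= ?(le_lt_trans ue)// (le_trans _ tb)// mono.
  by exists v => _.
have rhoM (u1 u2 : R) : 0 <= u1 -> u1 < u2 -> u2 <= eps -> rho u1 < rho u2.
  move=> u10 u12 u2e; have [r1 tr1] := rhoP u1 ltac:(lra).
  have [r2 tr2] := rhoP u2 ltac:(lra).
  rewrite ltNge; apply/negP => r21.
  have := mono' (rho u2) (rho u1) ltac:(lra) r21 ltac:(lra).
  by rewrite tr1 tr2 leNgt mg//; lra.
have rho0 : rho 0 = 0.
  have [/andP[r0 r1] tr] := rhoP 0 ltac:(lra).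
  apply/eqP; rewrite eq_le r0 andbT leNgt; apply/negP => rpos.
  by have := mg' 0 (rho 0) (lexx _) rpos ltac:(lra); rewrite tr tt0 ltxx.
exists eps, rho; split=> // u uI i; elim: i u uI => [|i ih] u uI.
  have [vI tv] := rhoP u uI.
  by have [_ ->] := g1 u ltac:(lra); have [_ ->] := g1' (rho u) ltac:(lra); rewrite tv.
have [u0|un0] := eqVneq u 0; first by rewrite u0 rho0.
(* At positive times the level-0 position is strictly inside its circle; since the bonding maps fix
   [o], no higher level can be at [o] either. *)
have avoid e2 (D : nat -> R -> T) (s : R -> R) b : (forall i u, D i u = F i (D i.+1 u)) ->
    right_germ (D 0%N) e2 a s -> b < e2 ->
    forall j v, 0 < v <= b -> F j (D j.+1 v) <> o.
  move=> DF [_ gD mD] be j v vI; rewrite -DF; elim: j => [|j ihj]; last first.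
    by move=> Do; apply: ihj; rewrite DF Do.
  have [sv ->] := gD v ltac:(lra); case: gB => g0 _ _ inj; rewrite -(g0 a) => /inj[].
  - have := mD 0 v (lexx _) ltac:(lra) ltac:(lra); have [] := gD 0 ltac:(lra); lra.
  - lra.
  - by move=> _ s0; have := mD 0 v (lexx _) ltac:(lra) ltac:(lra);
      have [] := gD 0 ltac:(lra); lra.
have [f1 [a1 [t1 h1]]] := gC i.+1; have [f2 [a2 [t2 h2]]] := gC' i.+1.
have [a12 t12] := agree _ _ _ _ _ _ _ h1 h2; move: h2; rewrite -{}a12 {a2} => h2.
have [tt P] := wF i a1.
have t101 : 0 <= t1 0 < 1 by have [f10 h1' _] := h1; have [] := h1' 0 ltac:(lra).
have [k ks kI] := pieces_locate P t101.
have u_gt0 : 0 < u by rewrite lt_neqAle eq_sym un0; case/andP: uI.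
have [|x xI Cx] := @stay_in_piece (F i) (w i) a1 tt (C i.+1) f1 t1 eps k
   P (cC i.+1) h1 ks kI (covC i.+1) _ u ltac:(lra); first exact: (avoid _ _ _ _ CF g epse i).
have [r01 _] := rhoP u uI; have := rhoM 0 u (lexx _) u_gt0 ltac:(lra); rewrite rho0 => r0.
move: kI; rewrite t12 => kI.
have [|y yI Cy] := @stay_in_piece (F i) (w i) a1 tt (C' i.+1) f2 t2 (e' / 2) k
   P (cC' i.+1) h2 ks kI (covC' i.+1) _ (rho u) ltac:(lra).
  by apply: (avoid _ _ _ _ CF' g' _ i); lra.
(* Both positions lie in the same open piece, where the bonding map is given by the strictly
   increasing [h], so equal images at level [i] force equal positions. *)
rewrite Cx Cy; congr gm.
have := ih u uI; rewrite CF CF' Cx Cy.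
have [_ [_ [_ /(_ k ks)[h [h0 [h1' [hm [_ hF]]]]]]]] := P.
have hI z : tt k < z < tt k.+1 -> 0 <= h z < 1.
  by move=> zI; rewrite -h0 -h1' ltW ?hm//; lra.
rewrite !hF; try lra.
move=> /(bouquet_inj1 (hI _ xI) (hI _ yI)) hxy.
case: (ltgtP x y) => // xy.
- by have := hm x y ltac:(lra) xy ltac:(lra); rewrite hxy ltxx.
- by have := hm y x ltac:(lra) xy ltac:(lra); rewrite hxy ltxx.
Qed.

End Germs.

(** * Rescaling the circles *)

Section IncreasingBijections.
Variable R : realType.
Implicit Types (a b c d e k x y u : R) (f g : R -> R).

(** Continuity is left out because it is automatic ([inc_bij_continuous]); in this form inverses,
    composites and gluings are purely order-theoretic. *)
Definition inc_bij f a b c d : Prop :=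
  [/\ forall x, a <= x <= b -> c <= f x <= d,
      forall x y, a <= x -> x < y -> y <= b -> f x < f y &
      forall y, c <= y <= d -> exists2 x, a <= x <= b & f x = y].

Lemma inc_bij_le f a b c d x y : inc_bij f a b c d ->
  a <= x -> x <= y -> y <= b -> f x <= f y.
Proof.
by move=> [_ m _] ax; rewrite le_eqVlt => /orP[/eqP -> //|? ?]; rewrite ltW// m.
Qed.

Lemma inc_bij_ends f a b c d : a <= b -> inc_bij f a b c d -> f a = c /\ f b = d.
Proof.
move=> ab fB; have [fI _ fS] := fB.
have := fI a ltac:(lra); have := fI b ltac:(lra) => fb fa.
have [x xI xc] := fS c ltac:(lra); have [y yI yd] := fS d ltac:(lra).
have := inc_bij_le fB (lexx a) (y := x) ltac:(lra) ltac:(lra).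
have := inc_bij_le fB (x := y) (y := b) ltac:(lra) ltac:(lra) (lexx b).
by split; lra.
Qed.

Lemma inc_bij_inj f a b c d x y : inc_bij f a b c d ->
  a <= x <= b -> a <= y <= b -> f x = f y -> x = y.
Proof.
move=> [_ m _] xI yI fxy; case: (ltgtP x y) => // xy.
- by have := m x y ltac:(lra) xy ltac:(lra); rewrite fxy ltxx.
- by have := m y x ltac:(lra) xy ltac:(lra); rewrite fxy ltxx.
Qed.

Lemma inc_bij_inv f a b c d : inc_bij f a b c d ->
  exists g, [/\ inc_bij g c d a b, forall x, a <= x <= b -> g (f x) = x &
                forall y, c <= y <= d -> f (g y) = y].
Proof.
move=> fB; have [fI m fS] := fB.
have /choice[g gP] y : exists x, c <= y <= d -> a <= x <= b /\ f x = y.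
  have [yI|] := boolP (c <= y <= d); last by exists 0.
  by have [x xI xy] := fS y yI; exists x.
have gf x : a <= x <= b -> g (f x) = x.
  by move=> xI; have [gI fg] := gP (f x) (fI x xI); exact: inc_bij_inj fB _ _ fg.
exists g; split=> //; last by move=> y /gP[].
split=> [y /gP[]//|x y cx xy yd|x xI]; last by exists (f x); [exact: fI|exact: gf].
have [gx fx] := gP x ltac:(lra); have [gy fy] := gP y ltac:(lra).
rewrite ltNge; apply/negP => yx.
have := inc_bij_le fB (x := g y) (y := g x) ltac:(lra) yx ltac:(lra).
by rewrite fx fy leNgt xy.
Qed.

Lemma inc_bij_comp f g a b c d e k : inc_bij f a b c d -> inc_bij g c d e k ->
  inc_bij (g \o f) a b e k.
Proof.
move=> [fI fm fS] [gI gm gS]; split=> [x /fI/gI//|x y ax xy yb|y /gS[x /fS[u uI <-] <-]].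
  by apply: gm; [have := fI x ltac:(lra); lra|exact: fm|have := fI y ltac:(lra); lra].
by exists u.
Qed.

Lemma inc_bij_glue f g a b c d e k : a <= b -> b < e ->
  inc_bij f a b c d -> inc_bij g b e d k ->
  inc_bij (fun x => if x <= b then f x else g x) a e c k /\
  forall x, b <= x -> (if x <= b then f x else g x) = g x.
Proof.
move=> ab be fB gB; have [fI fm fS] := fB; have [gI gm gS] := gB.
have [fa fb] := inc_bij_ends ab fB; have [gb ge] := inc_bij_ends (ltW be) gB.
split; last first.
  move=> x; rewrite le_eqVlt => /orP[/eqP <-|xb]; first by rewrite lexx fb gb.
  by rewrite leNgt xb.
have := fI a ltac:(lra); have := gI e ltac:(lra) => ? ?.
split=> [x xI|x y ax xy ye|y yI].
- by case: (leP x b) => xb; [have := fI x ltac:(lra)|have := gI x ltac:(lra)]; lra.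
- case: (leP x b) => xb; case: (leP y b) => yb; [exact: fm| |lra|exact: gm (ltW xb) xy ye].
  have := gm b y (lexx b) yb ye; have := inc_bij_le fB ax xb (lexx b); lra.
- case: (leP y d) => yd.
    by have [x xI <-] := fS y ltac:(lra); exists x; [lra|rewrite ifT//; lra].
  have [x xI xy] := gS y ltac:(lra); exists x; first lra.
  have : b != x by apply/eqP => bx; move: xy; rewrite -bx; lra.
  move=> bx; have : b < x by rewrite lt_neqAle bx; case/andP: xI.
  by rewrite leNgt => ->.
Qed.

Lemma inc_bij_glue_seq (tt tt' : nat -> R) (f : nat -> R -> R) (N : nat) :
  (forall i, (i < N)%N -> tt i < tt i.+1) ->
  (forall i, (i < N)%N -> inc_bij (f i) (tt i) (tt i.+1) (tt' i) (tt' i.+1)) ->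
  exists g, inc_bij g (tt 0%N) (tt N) (tt' 0%N) (tt' N) /\
    forall i u, (i < N)%N -> tt i <= u <= tt i.+1 -> g u = f i u.
Proof.
elim: N => [_ _|N ih tM fB].
  exists (fun=> tt' 0%N); split=> //; split=> [x _|x y|y]; first by rewrite lexx.
  - lra.
  - by exists (tt 0%N); lra.
have [||g [gB gf]] := ih.
- by move=> i iN; apply: tM; exact: ltnW.
- by move=> i iN; apply: fB; exact: ltnW.
have tle i : (i <= N)%N -> tt 0%N <= tt i.
  elim: i => // i ihi iN; apply: (le_trans (ihi (ltnW iN))).
  by apply/ltW/tM/ltnW.
have tle' i : (i < N)%N -> tt i.+1 <= tt N.
  elim: N {ih fB g gB gf tle} tM => // N ih tM; rewrite ltnS leq_eqVlt => /orP[/eqP->//|iN].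
  apply: (le_trans (ih _ iN)); last by apply/ltW/tM; exact: leqnSn.
  by move=> j jN; apply: tM; exact: ltnW.
have [hB hr] := inc_bij_glue (tle N (leqnn N)) (tM N (leqnn _)) gB (fB N (leqnn _)).
exists (fun x => if x <= tt N then g x else f N x); split=> // i u.
rewrite ltnS leq_eqVlt => /orP[/eqP->|iN] uI; first by apply: hr; lra.
by have := tle' i iN => ?; rewrite ifT; [exact: gf|lra].
Qed.

Lemma inc_bij_continuous f a b c d : a <= b -> inc_bij f a b c d ->
  {within `[a, b], continuous f}.
Proof.
move=> ab fB; have [fI fm fS] := fB; have [fa fb] := inc_bij_ends ab fB.
apply: segment_inc_surj_continuous.
  apply: le_mono_in => x y; rewrite !in_itv/= => xI yI xy; apply: fm => //; lra.
move=> y /=; rewrite in_itv/= fa fb => /fS[x xI xy]; by exists x.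
Qed.

Lemma inc_bij_of_continuous f a b c d : a <= b -> f a = c -> f b = d ->
  (forall x y, a <= x -> x < y -> y <= b -> f x < f y) ->
  {within `[a, b], continuous f} -> inc_bij f a b c d.
Proof.
move=> ab fa fb fm fc.
have fle x y : a <= x -> x <= y -> y <= b -> f x <= f y.
  by move=> ax; rewrite le_eqVlt => /orP[/eqP -> //|? ?]; rewrite ltW// fm.
split=> // [x xI|y yI].
  by rewrite -fa -fb !fle//; lra.
have cd : c <= d by lra.
have [|x xI xy] := IVT (v := y) ab fc; last by exists x; move: xI; rewrite ?in_itv.
by rewrite fa fb (min_idPl cd) (max_idPr cd).
Qed.

End IncreasingBijections.

(** * Circle rescalings and their lifts through positive maps *)

Section Rescaling.
Variables (R : realType) (n : nat) (T : topologicalType).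
Variables (gm : 'I_n -> R -> T) (o : T).
Hypothesis hT : hausdorff_space T.
Hypothesis gB : bouquet gm o.
Implicit Types (a b : 'I_n) (u v x : R) (G H : 'I_n -> R -> R) (F : T -> T).

Definition in_bouquet (q : T) : Prop := exists a x, 0 <= x <= 1 /\ q = gm a x.

Definition rescaling G : Prop := forall a, inc_bij (G a) 0 1 0 1.

(** The coordinates of [q] are chosen by [xget]. Only [o] has more than one pair of them, and
    rescalings fix the ends 0 and 1, so the choice does not matter on the bouquet ([rescaleE]). *)
Definition rescale G (q : T) : T := xget o
  [set q' | exists a u, [/\ 0 <= u <= 1, q = gm a u & q' = gm a (G a u)]].

Lemma rescaling_ends G a : rescaling G -> G a 0 = 0 /\ G a 1 = 1.
Proof. by move=> /(_ a)/(inc_bij_ends ler01). Qed.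

Lemma bouquet_eq a b u v : 0 <= u <= 1 -> 0 <= v <= 1 -> gm a u = gm b v ->
  (a = b /\ u = v) \/ ((u = 0 \/ u = 1) /\ (v = 0 \/ v = 1)).
Proof.
case: gB => _ _ _ inj u01 v01 h.
have op (z : R) : 0 <= z <= 1 -> z != 0 -> z != 1 -> 0 < z < 1.
  by move=> /andP[z0 z1] zn0 zn1; rewrite !lt_neqAle z0 z1 zn1 eq_sym zn0.
have [u0|un0] := eqVneq u 0; last have [u1|un1] := eqVneq u 1; last first.
- by left; exact: inj (op u u01 un0 un1) v01 h.
- have [v0|vn0] := eqVneq v 0; first by right; split; [right|left].
  have [v1|vn1] := eqVneq v 1; first by right; split; right.
  by left; have [-> ->] := inj b a v u (op v v01 vn0 vn1) u01 (esym h).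
- have [v0|vn0] := eqVneq v 0; first by right; split; left.
  have [v1|vn1] := eqVneq v 1; first by right; split; [left|right].
  by left; have [-> ->] := inj b a v u (op v v01 vn0 vn1) u01 (esym h).
Qed.

Lemma rescaleE G a u : rescaling G -> 0 <= u <= 1 ->
  rescale G (gm a u) = gm a (G a u).
Proof.
move=> GB u01; apply: xget_unique; first by exists a, u.
move=> _ [b [v [v01 h ->]]].
have [g0 g1 _ _] := gB.
have [[-> ->//]|[u0 v0]] := bouquet_eq u01 v01 h.
have [[Ga0 Ga1] [Gb0 Gb1]] := (rescaling_ends a GB, rescaling_ends b GB).
by case: u0 => ->; case: v0 => ->; rewrite ?Ga0 ?Ga1 ?Gb0 ?Gb1 ?g0 ?g1.
Qed.

Lemma rescale_in G q : rescaling G -> in_bouquet q -> in_bouquet (rescale G q).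
Proof.
move=> GB [a [u [u01 ->]]]; rewrite rescaleE//; exists a, (G a u); split=> //.
by have [+ _ _] := GB a; apply.
Qed.

(** The preimage of a closed set is the preimage under [c] of a finite union of compact subsets of
    circles. The map is composed with [c] because [rescale] is controlled only on the bouquet. *)
Lemma rescale_continuous G (Z : topologicalType) (c : Z -> T) : rescaling G ->
  continuous c -> (forall z, in_bouquet (c z)) -> continuous (fun z => rescale G (c z)).
Proof.
move=> GB cc cI; apply/continuous_closedP => K cK.
pose I01 : set R := [set u | 0 <= u <= 1].
have IE : I01 = `[0, 1]%classic by rewrite set_itvcc.
pose P a : set R := [set u | K (gm a (G a u))] `&` I01.
have -> : (fun z => rescale G (c z)) @^-1` K =
    c @^-1` (\bigcup_(a in [set: 'I_n]) (gm a @` P a)).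
  apply/seteqP; split=> z; rewrite /preimage /=.
    have [a [u [u01 cz]]] := cI z; rewrite cz rescaleE// => Kz.
    by exists a => //; exists u => //; split.
  by move=> [a _ [u [Ku u01] <-]]; rewrite rescaleE.
apply: closed_preimage => //; apply: closed_bigcup => [|a _]; first exact: finite_finset.
have gc : continuous (gm a) by case: gB.
apply: compact_closed => //; apply: continuous_compact.
  exact: continuous_subspaceT.
have cI01 : compact I01 by rewrite IE; exact: segment_compact.
apply: (subclosed_compact _ cI01); last by move=> u [].
have Gc : {within I01, continuous (gm a \o G a)}.
  move=> u; apply: (@continuous_comp (subspace I01) _ _ (G a) (gm a)); last exact: gc.
  by have := inc_bij_continuous ler01 (GB a); rewrite -IE; apply.
have /continuous_closedP/(_ K cK)/closed_subspaceP[V cV VE] := Gc.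
have -> : P a = V `&` I01 by rewrite VE.
by apply: closedI => //; apply: compact_closed => //; exact: Rhausdorff.
Qed.

(** The relation [F' o rescale G' = rescale G o F] on the bouquet, with circle coordinates kept
    visible so that it can be inverted directly. *)
Definition compatible F F' G G' : Prop := forall a u, 0 <= u <= 1 ->
  exists b x, [/\ 0 <= x <= 1, F (gm a u) = gm b x & F' (gm a (G' a u)) = gm b (G b x)].

Lemma rescale_compatible F F' G G' q : rescaling G -> rescaling G' ->
  compatible F F' G G' -> in_bouquet q -> F' (rescale G' q) = rescale G (F q).
Proof.
move=> GB GB' FG [a [u [u01 ->]]]; have [b [x [x01 Fq F'q]]] := FG a u u01.
by rewrite rescaleE// Fq rescaleE.
Qed.

(** On piece [k] the two maps run through the same circle with parametrisations [h] and [h'], so the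
    lift there is [h'^-1 o G o h]; these bijections are glued along the subdivision. *)
Lemma rescaling_lift F F' (w : endo n) G : rescaling G ->
  (forall a, exists tt, pieces gm (w a) F a tt) ->
  (forall a, exists tt, pieces gm (w a) F' a tt) ->
  exists G', rescaling G' /\ compatible F F' G G'.
Proof.
move=> GB wF wF'.
suff /choice[G' GP] a : exists g, inc_bij g 0 1 0 1 /\ forall u, 0 <= u <= 1 ->
    exists b x, [/\ 0 <= x <= 1, F (gm a u) = gm b x & F' (gm a (g u)) = gm b (G b x)].
  by exists G'; split=> a; [have [] := GP a|have [_] := GP a].
have [tt P] := wF a; have [tt' P'] := wF' a.
have [t0 [t1 [tm th]]] := P; have [t0' [t1' [tm' th']]] := P'.
pose link k f := inc_bij f (tt k) (tt k.+1) (tt' k) (tt' k.+1) /\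
  forall u, tt k <= u <= tt k.+1 ->
    exists b x, [/\ 0 <= x <= 1, F (gm a u) = gm b x & F' (gm a (f u)) = gm b (G b x)].
have /choice[f fP] k : exists f, (k < size (w a))%N -> link k f.
  have [ks|] := boolP (k < size (w a))%N; last by exists id.
  have [h [h0 [h1 [hm [hc hF]]]]] := th k ks.
  have [h' [h0' [h1' [hm' [hc' hF']]]]] := th' k ks.
  have hB : inc_bij h (tt k) (tt k.+1) 0 1.
    apply: inc_bij_of_continuous; rewrite ?set_itvcc//; exact/ltW/tm.
  have hB' : inc_bij h' (tt' k) (tt' k.+1) 0 1.
    apply: inc_bij_of_continuous; rewrite ?set_itvcc//; exact/ltW/tm'.
  have [r [rB _ hr]] := inc_bij_inv hB'.
  have [hI _ _] := hB; have [rI _ _] := rB.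
  exists (r \o (G (nth a (w a) k) \o h)) => _; split.
    exact: inc_bij_comp (inc_bij_comp hB (GB _)) rB.
  move=> u uI; exists (nth a (w a) k), (h u); split; [exact: hI|exact: hF|].
  have GI : 0 <= G (nth a (w a) k) (h u) <= 1.
    by have [+ _ _] := GB (nth a (w a) k); apply; exact: hI.
  by rewrite hF' /= ?hr//; exact: rI.
have [|g [gB' gf]] := @inc_bij_glue_seq _ tt tt' f (size (w a)) tm.
  by move=> k /fP[].
exists g; split; first by move: gB'; rewrite t0 t1 t0' t1'.
(* [pieces_locate] uses half-open pieces and misses [u = 1], which is put in the last piece by
   hand. *)
move=> u u01; have [u1|un1] := eqVneq u 1.
  have sz : (0 < size (w a))%N.
    by rewrite lt0n; apply/eqP => s0; move: t1; rewrite s0 t0 => /eqP; rewrite eq_sym oner_eq0.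
  have sE := prednK sz; have ks : ((size (w a)).-1 < size (w a))%N by rewrite sE.
  have uI : tt (size (w a)).-1 <= u <= tt (size (w a)).-1.+1.
    by have := tm _ ks; rewrite sE t1 u1; lra.
  by rewrite (gf _ _ ks uI); have [_] := fP _ ks; apply.
have u01' : 0 <= u < 1 by move: u01 => /andP[-> u1]; rewrite lt_neqAle un1.
have [k ks /andP[k0 k1]] := pieces_locate P u01'.
have uI : tt k <= u <= tt k.+1 by lra.
by rewrite (gf _ _ ks uI); have [_] := fP _ ks; apply.
Qed.

Lemma rescaling_inv G : rescaling G -> exists H, [/\ rescaling H,
  forall a x, 0 <= x <= 1 -> H a (G a x) = x & forall a x, 0 <= x <= 1 -> G a (H a x) = x].
Proof.
move=> GB; have /choice[H HP] a := inc_bij_inv (GB a).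
by exists H; split=> a; have [] := HP a.
Qed.

Lemma rescale_cancel G H q : rescaling G -> rescaling H ->
  (forall a x, 0 <= x <= 1 -> H a (G a x) = x) -> in_bouquet q ->
  rescale H (rescale G q) = q.
Proof.
move=> GB HB HG [a [u [u01 ->]]]; rewrite rescaleE// rescaleE ?HG//.
by have [+ _ _] := GB a; apply.
Qed.

Lemma rescalings_exist (F F' : nat -> T -> T) (w : nat -> endo n) :
  (forall i a, exists tt, pieces gm (w i a) (F i) a tt) ->
  (forall i a, exists tt, pieces gm (w i a) (F' i) a tt) ->
  exists G : nat -> 'I_n -> R -> R, (forall i, rescaling (G i)) /\
    forall i, compatible (F i) (F' i) (G i) (G i.+1).
Proof.
move=> wF wF'.
(* Guarding by [rescaling p.2] makes the step a total function, as the recursion requires; its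
   values elsewhere are arbitrary. *)
have /choice[step stepP] (p : nat * ('I_n -> R -> R)) : exists G', rescaling p.2 ->
    rescaling G' /\ compatible (F p.1) (F' p.1) p.2 G'.
  have [GB|] := pselect (rescaling p.2); last by exists p.2.
  by have [G' ?] := rescaling_lift GB (wF p.1) (wF' p.1); exists G'.
pose G := fix G i := if i is j.+1 then step (j, G j) else fun _ => id.
have GB i : rescaling (G i).
  elim: i => [a|i ih]; last by have [] := stepP (i, G i) ih.
  by split=> // y yI; exists y.
by exists G; split=> // i; have [] := stepP (i, G i) (GB i).
Qed.

End Rescaling.

(** * Expansions and orbits *)

Section Chains.
Variable R : realType.
Implicit Types (a b c s t e : R).

(** Continuous induction: take the supremum of the points linked to [a]. A left-hand local link
    reaches it, and a right-hand one passes beyond it unless it is [b]. *)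
Lemma real_chain (E : R -> R -> Prop) :
  (forall a b c, a <= b -> b <= c -> E a b -> E b c -> E a c) ->
  (forall t, exists2 e, 0 < e & (forall s, t <= s <= t + e -> E t s) /\
                                (forall s, t - e <= s <= t -> E s t)) ->
  forall a b, a <= b -> E a b.
Proof.
move=> tr loc a b ab.
pose S : set R := [set t | a <= t <= b /\ E a t].
have Sa : S a.
  by split; [lra|have [e e0 [+ _]] := loc a; apply; lra].
have Sub : has_ubound S by exists b => t [/andP[]].
have supS : has_sup S by split=> //; exists a.
have ubS t : S t -> t <= sup S by move=> St; exact: ub_le_sup.
have supb : sup S <= b by apply: ge_sup; [exists a|move=> t [/andP[]]].
have [e e0 [Er El]] := loc (sup S).
have [t St te] := sup_adherent e0 supS.
have tS := ubS t St; have [tI Et] := St.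
have ES : E a (sup S) by apply: (tr _ t) => //; [lra|apply: El; lra].
move: supb; rewrite le_eqVlt => /orP[/eqP <- //|supb].
pose s := Num.min (sup S + e) b.
have sb : s <= b by rewrite /s ge_min lexx orbT.
have se : s <= sup S + e by rewrite /s ge_min lexx.
have Ss : sup S < s by rewrite /s lt_min supb andbT; lra.
have : S s.
  split; first lra.
  by apply: (tr _ (sup S)) => //; [lra|lra|apply: Er; lra].
by move=> /ubS; rewrite leNgt Ss.
Qed.

Variables (Y : Type) (psi : R -> Y -> Y).
Hypothesis psi0 : forall y, psi 0 y = y.
Hypothesis psiD : forall s t y, psi (s + t) y = psi s (psi t y).
Variable c : R -> Y.

Definition clock a b : Prop := exists tau : R -> R, [/\ tau a = 0,
  forall s t, a <= s -> s < t -> t <= b -> tau s < tau t &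
  forall u, a <= u <= b -> c u = psi (tau u) (c a)].

Lemma clock_trans (a b d : R) : a <= b -> b <= d -> clock a b -> clock b d -> clock a d.
Proof.
move=> ab bd [s [sa sm sc]] [t [tb tm tc]].
have sle x : a <= x -> x <= b -> s x <= s b.
  by move=> ax; rewrite le_eqVlt => /orP[/eqP -> //|xb]; rewrite ltW// sm.
have tge x : b < x -> x <= d -> 0 < t x by move=> bx xd; rewrite -tb tm.
exists (fun u => if u <= b then s u else s b + t u); split.
- by rewrite ab.
- move=> x y ax xy yd; case: (leP x b) => xb; case: (leP y b) => yb; last 2 first.
  + lra.
  + by rewrite ltrD2l tm// ltW.
  + exact: sm.
  + have := tge y yb yd; have := sle x ax xb; lra.
- move=> u uI; case: leP => ub; first by apply: sc; lra.
  by rewrite addrC psiD -sc ?lexx ?ab//; apply: tc; lra.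
Qed.

(** The discrete primitive of [d] over the integers vanishing at 0; note that [Negz j] is
    [-(j + 1)]. *)
Definition dsum (d : int -> R) (k : int) : R :=
  match k with
  | Posz i => \sum_(j < i) d j
  | Negz i => - \sum_(j < i.+1) d (Negz j)
  end.

Lemma dsumS d k : dsum d (k + 1) = dsum d k + d k.
Proof.
case: k => [i|[|i]].
- by rewrite -PoszD addn1 /= big_ord_recr.
- by rewrite /= big_ord0 big_ord_recr big_ord0 /= add0r addNr.
- have -> : Negz i.+1 + 1 = Negz i by lia.
  by rewrite /dsum [in RHS]big_ord_recr/= opprD addrNK.
Qed.

Lemma dsum_le d k l : (forall i, 0 < d i) -> k <= l -> dsum d k <= dsum d l.
Proof.
move=> d0 kl; have -> : l = k + `|l - k|%N by lia.
elim: `|l - k|%N => [|i ih]; first by rewrite addr0.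
apply: (le_trans ih); rewrite -addn1 PoszD addrA dsumS; have := d0 (k + i); lra.
Qed.

(** On a periodic orbit clocks are not unique, so those of growing intervals need not extend each
    other. One is chosen on each [[k, k + 1]], and they are stacked by their cumulated increments
    [dsum d]. *)
Lemma global_clock : (forall a b, a <= b -> clock a b) ->
  exists tau : R -> R, (forall s t, s < t -> tau s < tau t) /\
    forall t, c t = psi (tau t) (c 0).
Proof.
move=> ck; have /choice[f fP] (k : int) : exists f : R -> R, [/\ f k%:~R = 0,
    forall s t, k%:~R <= s -> s < t -> t <= (k + 1)%:~R -> f s < f t &
    forall u, k%:~R <= u <= (k + 1)%:~R -> c u = psi (f u) (c k%:~R)].
  by apply: ck; rewrite ler_int; lia.
have ltk (k : int) : k%:~R < (k + 1)%:~R :> R by rewrite ltr_int; lia.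
pose d k := f k (k + 1)%:~R.
have d0 k : 0 < d k.
  by have [f0 fm _] := fP k; rewrite -f0; apply: fm => //.
have cS k : c k%:~R = psi (dsum d k) (c 0).
  have step i : c (i + 1)%:~R = psi (d i) (c i%:~R).
    by have [_ _ fc] := fP i; apply: fc; rewrite (ltW (ltk i)) lexx.
  elim/int_ind: k => [|i ih|i ih]; first by rewrite /= big_ord0 psi0.
    have -> : i.+1%:Z = i%:Z + 1 by lia.
    by rewrite step dsumS ih -psiD addrC.
  (* Towards negative integers the relation between consecutive values is solved backwards by
     applying [psi] at the opposite time. *)
  move: ih; have -> : (- i%:Z = - i.+1%:Z + 1) by lia.
  have psiK (r : R) y : psi (- r) (psi r y) = y by rewrite -psiD addNr psi0.
  rewrite step dsumS [_ + d _]addrC psiD => /(congr1 (psi (- d (- i.+1%:Z)))).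
  by rewrite !psiK.
pose fl t : int := Num.floor t.
have flI t : (fl t)%:~R <= t < (fl t + 1)%:~R by exact: floor_itv.
exists (fun t => dsum d (fl t) + f (fl t) t); split.
  move=> s t st; have := flI s; have := flI t => tI sI.
  have flst : fl s <= fl t by apply: le_floor; exact: ltW.
  move: flst; rewrite le_eqVlt => /orP[/eqP e|lst].
    rewrite -e ltrD2l; have [_ fm _] := fP (fl s); apply: fm => //; first by case/andP: sI.
    by rewrite e; case/andP: tI => _ /ltW.
  have h1 : f (fl s) s < d (fl s).
    by have [_ fm _] := fP (fl s); apply: fm => //; [case/andP: sI|case/andP: sI].
  have h2 : 0 <= f (fl t) t.
    have [f0 fm _] := fP (fl t); move: (tI) => /andP[+ _].
    rewrite le_eqVlt => /orP[/eqP tt|tt]; first by rewrite -[leLHS]f0 [X in f _ X]tt.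
    have : f (fl t) (fl t)%:~R < f (fl t) t by apply: fm => //; lra.
    by rewrite f0 => /ltW.
  have := @dsum_le d (fl s + 1) (fl t) d0; rewrite dsumS lezD1 => /(_ lst).
  lra.
move=> t; have [_ _ fc] := fP (fl t); rewrite (fc t); last first.
  by case/andP: (flI t) => -> /ltW.
by rewrite cS -psiD addrC.
Qed.

End Chains.

(** * Expansions, their shifts and the germs of their orbits *)

Section Expansions.
Variables (R : realType) (n : nat).
Local Notation plane := (R * R)%type.
Local Notation gm := (@gam R n).
Local Notation gr := (fun (j : 'I_n) (t : R) => @gam R n j (1 - t)).

Lemma within_comp (Z T T' : topologicalType) (A : set T) (f : T -> T') (c : Z -> T) :
  {within A, continuous f} -> continuous c -> (forall z, A (c z)) ->
  continuous (fun z => f (c z)).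
Proof.
move=> /continuous_closedP fc cc cA; apply/continuous_closedP => K cK.
have /closed_subspaceP[V cV VE] := fc K cK.
have -> : (fun z => f (c z)) @^-1` K = c @^-1` V.
  apply/seteqP; split=> z /= Kz; have : (V `&` A) (c z) <-> (f @^-1` K `&` A) (c z) by rewrite VE.
  - by case=> _ h; have [] := h (conj Kz (cA z)).
  - by case=> h _; have [] := h (conj Kz (cA z)).
exact: closed_preimage.
Qed.

(* reversing every circle exchanges the two sides of a time t *)
Lemma pieces_rev (w : seq 'I_n) (F : plane -> plane) a tt : pieces gm w F a tt ->
  pieces gr (rev w) F a (fun k => 1 - tt (size w - k)%N).
Proof.
move=> [t0 [t1 [tm th]]]; rewrite /pieces size_rev subn0 subnn t0 t1 subrr subr0.
have idx k : (k < size w)%N -> (size w - k = (size w - k.+1).+1)%N by lia.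
do 2!split=> //; split=> [k ks|k ks].
  by rewrite (idx k ks) ltrD2l ltrN2; apply: tm; lia.
have ls : (size w - k.+1 < size w)%N by lia.
rewrite (idx k ks); set l := (size w - k.+1)%N in ls *.
have [h [h0 [h1 [hm [hc hF]]]]] := th l ls.
have hm' (s1 s2 : R) : 1 - tt l.+1 <= s1 -> s1 < s2 -> s2 <= 1 - tt l ->
    1 - h (1 - s1) < 1 - h (1 - s2).
  by move=> ? ? ?; rewrite ltrD2l ltrN2; apply: hm; lra.
have ll := tm l ls.
have hB : inc_bij h (tt l) (tt l.+1) 0 1.
  by apply: inc_bij_of_continuous; rewrite ?set_itvcc// ltW.
exists (fun u => 1 - h (1 - u)); rewrite !subKr h0 h1 subrr subr0.
split=> //; split=> //; split=> //; split; last first.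
  move=> u uI; rewrite hF; last lra.
  by rewrite nth_rev// subKr.
rewrite -set_itvcc; apply: (@inc_bij_continuous _ _ _ _ 0 1); first lra.
have [hI _ hS] := hB; split=> // [x xI|y yI].
  by have := hI (1 - x) ltac:(lra); lra.
have [x xI xy] := hS (1 - y) ltac:(lra); exists (1 - x); first lra.
by rewrite subKr xy subKr.
Qed.

(* exp_initial, unlike the neighbourhood-base clause of admissible_expansion,
   is visibly stable under forgetting the first levels *)
Record expansion (X : topologicalType) (phi : R -> X -> X) (w : nat -> endo n)
    (f : nat -> plane -> plane) (p : nat -> X -> plane) : Prop := Expansion {
  exp_map : forall i, positive_map_for R (w i) (f i);
  exp_cont : forall i, continuous (p i);
  exp_wedge : forall i x, wedge R n (p i x);
  exp_along : forall i, along_orbits n phi (p i);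
  exp_comm : forall i x, p i x = f i (p i.+1 x);
  exp_inj : forall x y, (forall i, p i x = p i y) -> x = y;
  exp_thread : forall y : nat -> plane, (forall i, wedge R n (y i)) ->
    (forall i, y i = f i (y i.+1)) -> exists x, forall i, p i x = y i;
  exp_initial : forall (Z : topologicalType) (h : Z -> X),
    (forall i, continuous (p i \o h)) -> continuous h }.

Lemma admissible_expansionP (m : nat) (sigma : 'I_m -> endo n) (X : topologicalType)
    (phi : R -> X -> X) sq : admissible_expansion sigma phi sq ->
  exists f p, expansion phi (fun i => sigma (sq i)) f p.
Proof.
move=> [x0 [f [p [fm [pc [pW [_ [pa [_ [pf [pinj [pth ptop]]]]]]]]]]]].
exists f, p; split=> // Z h hc z A /=.
rewrite nbhsE => -[U [oU Uh] UA].
have [N [V [oV [VN VU]]]] := ptop U oU (h z) Uh.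
suff : \forall z' \near z, forall k, (k <= N)%N -> V k (p k (h z')).
  by apply: filterS => z' /VU/UA.
elim: N VN {VU} => [|N ih] VN.
  have : \forall z' \near z, V 0%N (p 0%N (h z')).
    by apply: (hc 0%N z); apply: open_nbhs_nbhs; split=> //; exact: VN.
  by apply: filterS => z' Vz k; rewrite leqn0 => /eqP ->.
have h1 : \forall z' \near z, V N.+1 (p N.+1 (h z')).
  by apply: (hc N.+1 z); apply: open_nbhs_nbhs; split=> //; exact: VN.
have h2 := ih (fun k kN => VN k (leqW kN)).
apply: filterS2 h1 h2 => z' V1 V2 k; rewrite leq_eqVlt => /orP[/eqP -> //|].
exact: V2.
Qed.

(** It suffices to drop one level, which is recovered as the image of the next one under [f 0]; this
    extends threads downwards and restores continuity of the dropped projection. *)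
Lemma expansion_shift (X : topologicalType) (phi : R -> X -> X) w f p (k : nat) :
  expansion phi w f p -> expansion phi (fun i => w (k + i)%N)
    (fun i => f (k + i)%N) (fun i => p (k + i)%N).
Proof.
elim: k w f p => [//|k ih] w f p E.
suff E1 : expansion phi (fun i => w i.+1) (fun i => f i.+1) (fun i => p i.+1).
  exact: ih E1.
have [fc [fW _]] := exp_map E 0%N.
split=> [i|i|i x|i|i x|x y pxy|y yW yf|Z h hc].
- exact: (exp_map E i.+1).
- exact: (@exp_cont _ _ _ _ _ E i.+1).
- exact: (exp_wedge E i.+1).
- exact: (exp_along E i.+1).
- exact: (exp_comm E i.+1).
- by apply: (exp_inj E) => -[|//]; rewrite !(exp_comm E 0%N) pxy.
- have [||x xy] := exp_thread E (y := fun i => if i is j.+1 then y j else f 0%N (y 0%N)).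
  + by case=> //; exact: fW.
  + by case.
  + by exists x => i; rewrite (xy i.+1).
- apply: (exp_initial E) => -[|//].
  have -> : p 0%N \o h = fun z => f 0%N ((p 1%N \o h) z).
    by apply/funext => z /=; exact: exp_comm E 0%N _.
  by apply: within_comp fc (hc 0%N) _ => z; exact: exp_wedge E 1%N _.
Qed.

(** The germ of the orbit through [x] supplies the circle index that [wedgeP] asks for. *)
Lemma expansion_in_bouquet (X : topologicalType) (phi : R -> X -> X) w f p i x :
  expansion phi w f p -> in_bouquet gm (p i x).
Proof.
move=> E; have [_ [e [j _]]] := exp_along E i x 0.
exact: wedgeP j (exp_wedge E i x).
Qed.

Lemma in_bouquet_wedge q : in_bouquet gm q -> wedge R n q.
Proof. by move=> [a [u [_ ->]]]; exact: wedge_gam. Qed.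

Lemma along_right (X : Type) (phi : R -> X -> X) p x : along_orbits n phi p ->
  exists e a th, right_germ gm (fun u => p (phi u x)) e a th.
Proof.
move=> /(_ x 0)[_ [e [_ [a [_ [th [e0 [_ [_ [thI thm]]]]]]]]]].
by exists e, a, th; split=> //; move: thI thm; rewrite add0r.
Qed.

Lemma along_left (X : Type) (phi : R -> X -> X) p x : along_orbits n phi p ->
  exists e a th, right_germ gr (fun u => p (phi (- u) x)) e a th.
Proof.
move=> /(_ x 0)[_ [e [a [_ [th [_ [e0 [thI [thm _]]]]]]]]].
exists e, a, (fun u => 1 - th (- u)); split=> [//|u uI|u1 u2 ? ? ?].
  by have [thu ->] := thI (- u) ltac:(lra); split; [lra|rewrite subKr].
by rewrite ltrD2l ltrN2; apply: thm; lra.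
Qed.

Lemma rescale_right_germ G (C : R -> plane) e a th : rescaling G ->
  right_germ gm C e a th ->
  right_germ gm (fun u => rescale gm (wpt R) G (C u)) e a (G a \o th).
Proof.
move=> GB [e0 gC mC]; have [GI Gm _] := GB a; have [G0 G1] := rescaling_ends a GB.
split=> // [u uI|u1 u2 u10 u12 u2e]; last first.
  have := gC u1 ltac:(lra); have := gC u2 ltac:(lra) => -[? _] [? _].
  by apply: Gm; [lra|exact: mC|lra].
have [thu ->] := gC u uI; split; last by apply: (rescaleE (@gam_bouquet R n)) => //; lra.
have /andP[-> _] := GI (th u) ltac:(lra).
by rewrite -G1; apply: Gm; lra.
Qed.

Lemma rescale_left_germ G (C : R -> plane) e a th : rescaling G ->
  right_germ gr C e a th ->
  right_germ gr (fun u => rescale gm (wpt R) G (C u)) e a (fun u => 1 - G a (1 - th u)).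
Proof.
move=> GB [e0 gC mC]; have [GI Gm _] := GB a; have [G0 G1] := rescaling_ends a GB.
split=> // [u uI|u1 u2 u10 u12 u2e]; last first.
  have := gC u1 ltac:(lra); have := gC u2 ltac:(lra) => -[? _] [? _].
  have := mC u1 u2 u10 u12 u2e => ?.
  by rewrite ltrD2l ltrN2; apply: Gm; lra.
have [thu ->] := gC u uI; rewrite subKr; split.
  have := GI (1 - th u) ltac:(lra); have : G a 0 < G a (1 - th u) by apply: Gm; lra.
  by rewrite G0; lra.
by apply: (rescaleE (@gam_bouquet R n)) => //; lra.
Qed.

(** * Positive lines in the limit follow orbits *)

Section Follow.
Variables (Y : topologicalType) (psi : R -> Y -> Y) (w : nat -> endo n).
Variables (f : nat -> plane -> plane) (q : nat -> Y -> plane).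
Hypothesis E : expansion psi w f q.
Hypothesis psi_flow : is_flow psi.
Hypothesis w_proper : forall i, proper_endo (w i).

Lemma flow_line_continuous y : continuous (fun t => psi t y).
Proof.
have [pc _] := psi_flow => t.
apply: (@continuous_comp _ _ _ (fun t : R => (t, y)) (fun z : R * Y => psi z.1 z.2)).
  by apply: (@cvg_pair _ _ _ _ (nbhs _) (nbhs _)); [exact: cvg_id|exact: cvg_cst].
exact: pc.
Qed.

(** The images of [c] and of the flow line through [c 0] are two positive lines from the same point,
    so [right_germ_unique] matches them at all levels, and the projections separate points. *)
Lemma follow_right (c : R -> Y) : continuous c ->
  (forall i, exists e a th, right_germ gm (fun u => q i (c u)) e a th) ->
  exists e rho, [/\ 0 < e, rho 0 = 0,
    forall u1 u2 : R, 0 <= u1 -> u1 < u2 -> u2 <= e -> rho u1 < rho u2 &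
    forall u, 0 <= u <= e -> c u = psi (rho u) (c 0)].
Proof.
move=> cc gc; have [_ [psi0 _]] := psi_flow.
have comp_cont (c' : R -> Y) i : continuous c' -> continuous (fun u => q i (c' u)).
  by move=> cc' t; apply: continuous_comp; [exact: cc'|exact: exp_cont E i _].
have [||||i|i u|i u|i u|i u|i|i|i|e [rho [e0 r0 rm rc]]] := @right_germ_unique _ _ _ gm (wpt R)
  (@plane_hausdorff R) (@gam_bouquet R n) f w (fun i u => q i (c u))
  (fun i u => q i (psi u (c 0))).
- by move=> i; have [_ [_ [_ []]]] := exp_map E i.
- by move=> i a; have [_ [_ [_ [_]]]] := exp_map E i; apply.
- move=> i; have [a [d h]] := w_proper i; exists a => j.
  by have [v ->] := h j; exists (rcons v d).
- by move=> i; exact: comp_cont.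
- exact/comp_cont/flow_line_continuous.
- exact: exp_comm E i _.
- exact: exp_comm E i _.
- exact: expansion_in_bouquet E.
- exact: expansion_in_bouquet E.
- exact: gc.
- exact: (@along_right _ psi (q i) (c 0) (@exp_along _ _ _ _ _ E i)).
- by rewrite psi0.
exists e, rho; split=> // u uI; apply: (exp_inj E) => i; exact: rc.
Qed.

(** Time, circles and words are all reversed; the common last letter provided by properness becomes
    the common first letter. *)
Lemma follow_left (c : R -> Y) : continuous c ->
  (forall i, exists e a th, right_germ gr (fun u => q i (c (- u))) e a th) ->
  exists e rho, [/\ 0 < e, rho 0 = 0,
    forall u1 u2 : R, 0 <= u1 -> u1 < u2 -> u2 <= e -> rho u1 < rho u2 &
    forall u, 0 <= u <= e -> c (- u) = psi (- rho u) (c 0)].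
Proof.
move=> cc gc; have [_ [psi0 _]] := psi_flow.
have comp_cont (c' : R -> Y) i : continuous c' -> continuous (fun u => q i (c' (- u))).
  move=> cc' t; apply: (@continuous_comp _ _ _ (fun u => c' (- u)) (q i)).
    by apply: (@continuous_comp _ _ _ -%R c'); [exact: opp_continuous|exact: cc'].
  exact: (@exp_cont _ _ _ _ _ E i).
have covr i y : exists a x, 0 <= x <= 1 /\ q i y = gr a x.
  have [a [x [xI ->]]] := expansion_in_bouquet i y E.
  by exists a, (1 - x); split; [lra|rewrite subKr].
have [||||i|i u|i u|i u|i u|i|i|i|e [rho [e0 r0 rm rc]]] := @right_germ_unique _ _ _ gr (wpt R)
  (@plane_hausdorff R) (@gam_rev_bouquet R n) f (fun i j => rev (w i j))
  (fun i u => q i (c (- u))) (fun i u => q i (psi (- u) (c 0))).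
- by move=> i; have [_ [_ [_ []]]] := exp_map E i.
- move=> i a; have [_ [_ [_ [_ /(_ a)[tt P]]]]] := exp_map E i.
  by eexists; exact: pieces_rev P.
- move=> i; have [a [d h]] := w_proper i; exists d => j.
  by have [v ->] := h j; exists (rcons (rev v) a); rewrite rev_cons rev_rcons.
- by move=> i; exact: comp_cont.
- by apply: (comp_cont (fun t => psi t (c 0))); exact: flow_line_continuous.
- exact: exp_comm E i _.
- exact: exp_comm E i _.
- exact: covr.
- exact: covr.
- exact: gc.
- exact: (@along_left _ psi (q i) (c 0) (@exp_along _ _ _ _ _ E i)).
- by rewrite oppr0 psi0.
exists e, rho; split=> // u uI; apply: (exp_inj E) => i; exact: rc.
Qed.

Lemma follow_orbit (c : R -> Y) : continuous c ->
  (forall t i, exists e a th, right_germ gm (fun u => q i (c (t + u))) e a th) ->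
  (forall t i, exists e a th, right_germ gr (fun u => q i (c (t - u))) e a th) ->
  exists tau : R -> R, (forall s t, s < t -> tau s < tau t) /\
    forall t, c t = psi (tau t) (c 0).
Proof.
move=> cc gR gL; have [_ [psi0 psiD]] := psi_flow.
apply: global_clock => //; apply: real_chain; first exact: clock_trans.
move=> t; have ct : continuous (fun u => c (t + u)).
  move=> u; apply: (@continuous_comp _ _ _ (fun u => t + u) c); last exact: cc.
  by apply: cvgD; [exact: cvg_cst|exact: cvg_id].
have [e1 [r [e10 r0 rm rc]]] := follow_right ct (gR t).
have [e2 [l [e20 l0 lm lc]]] := follow_left ct (gL t).
rewrite addr0 in rc lc.
pose e := Num.min e1 e2.
have ee1 : e <= e1 by rewrite /e ge_min lexx.
have ee2 : e <= e2 by rewrite /e ge_min lexx orbT.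
exists e; first by rewrite /e lt_min e10.
split=> s sI.
  exists (fun u => r (u - t)); split=> [|x y ? ? ?|u uI]; first by rewrite subrr.
    by apply: rm; lra.
  by rewrite -rc ?subrKC//; lra.
(* The left clock counts time back from [c t]; based at [c s] instead, it becomes
   [l (t - s) - l (t - u)]. *)
have ctE : c t = psi (l (t - s)) (c s).
  have := lc (t - s) ltac:(lra); rewrite opprB subrKC => ->.
  by rewrite -psiD addrN psi0.
exists (fun u => l (t - s) - l (t - u)); split=> [|x y ? ? ?|u uI]; first by rewrite subrr.
  by rewrite ltrD2l ltrN2; apply: lm; lra.
have := lc (t - u) ltac:(lra); rewrite opprB subrKC => ->.
by rewrite ctE -psiD addrC.
Qed.

End Follow.

(** * The limit of compatible rescalings *)

Section Conjugacy.
Variables (X Y : topologicalType) (phi : R -> X -> X) (psi : R -> Y -> Y).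
Variables (w : nat -> endo n) (f f' : nat -> plane -> plane).
Variables (p : nat -> X -> plane) (q : nat -> Y -> plane) (G : nat -> 'I_n -> R -> R).
Hypothesis EX : expansion phi w f p.
Hypothesis EY : expansion psi w f' q.
Hypothesis GB : forall i, rescaling (G i).
Hypothesis GC : forall i, compatible gm (f i) (f' i) (G i) (G i.+1).
Local Notation resc := (rescale gm (wpt R)).

(** Compatibility turns threads of [X] into threads of [Y]; continuity can be tested level by
    level. *)
Lemma limit_map : exists h : X -> Y, continuous h /\ 
  forall i x, q i (h x) = resc (G i) (p i x).
Proof.
have gB := @gam_bouquet R n.
have pI i x : in_bouquet gm (p i x) by exact: expansion_in_bouquet EX.
have /choice[h hP] x : exists y, forall i, q i y = resc (G i) (p i x).
  apply: (exp_thread EY) => i; first exact/in_bouquet_wedge/rescale_in.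
  by rewrite (exp_comm EX) (rescale_compatible gB (GB i) (GB i.+1) (GC i)).
exists h; split=> //; apply: (exp_initial EY) => i.
have -> : q i \o h = fun x => resc (G i) (p i x) by apply/funext => x /=; rewrite hP.
exact: (rescale_continuous (@plane_hausdorff R) gB (GB i) (@exp_cont _ _ _ _ _ EX i)).
Qed.

(** Rescalings keep outgoing and incoming germs positive, so the image of an orbit is a line to
    which [follow_orbit] applies. *)
Lemma limit_map_orbit (h : X -> Y) x : continuous h ->
  (forall i x, q i (h x) = resc (G i) (p i x)) ->
  is_flow phi -> is_flow psi -> (forall i, proper_endo (w i)) ->
  exists tau : R -> R, (forall s t, s < t -> tau s < tau t) /\
    forall t, h (phi t x) = psi (tau t) (h x).
Proof.
move=> hc hq phi_flow psi_flow wp; have [_ [phi0 phiD]] := phi_flow.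
have [|t i|t i|tau [tauM tauE]] := @follow_orbit Y psi w f' q EY psi_flow wp (fun t => h (phi t x)).
- move=> t; apply: continuous_comp; last exact: hc.
  exact: flow_line_continuous phi_flow _ _.
- have [e [a [th g]]] := @along_right _ phi (p i) (phi t x) (@exp_along _ _ _ _ _ EX i).
  exists e, a, (G i a \o th).
  have -> : (fun u => q i (h (phi (t + u) x))) = fun u => resc (G i) (p i (phi u (phi t x))).
    by apply/funext => u; rewrite hq addrC phiD.
  exact: rescale_right_germ (GB i) g.
- have [e [a [th g]]] := @along_left _ phi (p i) (phi t x) (@exp_along _ _ _ _ _ EX i).
  exists e, a, (fun u => 1 - G i a (1 - th u)).
  have -> : (fun u => q i (h (phi (t - u) x))) = fun u => resc (G i) (p i (phi (- u) (phi t x))).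
    by apply/funext => u; rewrite hq addrC phiD.
  exact: rescale_left_germ (GB i) g.
by exists tau; split=> // t; rewrite tauE phi0.
Qed.

End Conjugacy.

End Expansions.

(** * Transporting expansions *)

Section Transport.
Variable R : realType.
Local Notation plane := (R * R)%type.

Lemma separating_hausdorff (Y Z : topologicalType) (I : Type) (q : I -> Y -> Z) :
  hausdorff_space Z -> (forall i, continuous (q i)) ->
  (forall y y', (forall i, q i y = q i y') -> y = y') -> hausdorff_space Y.
Proof.
move=> hZ qc sep y y' yy'; apply: sep => i; apply: hZ => A B nA nB.
by have [z [Az Bz]] := yy' _ _ (qc i y A nA) (qc i y' B nB); exists (q i z).
Qed.

(** The last hypothesis says that [(t, L)] lies in the closure of the graph of [tau]; limits in [Y]
    are unique. *)
Lemma value_at_jump (Y : topologicalType) (c ps : R -> Y) (tau : R -> R) (t L : R) :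
  hausdorff_space Y -> continuous c -> continuous ps -> (forall u, c u = ps (tau u)) ->
  (forall e, 0 < e -> exists u, `|t - u| < e /\ `|L - tau u| < e) -> ps L = c t.
Proof.
move=> hY cc cps cE near; apply: hY => A B nA nB.
have /nbhs_ballP[e1 /= e10 A1] := cps L A nA.
have /nbhs_ballP[e2 /= e20 B2] := cc t B nB.
have [|u [ut uL]] := near (Num.min e1 e2); first by rewrite lt_min e10.
exists (c u); split; first by rewrite cE; apply: A1; apply: (lt_le_trans uL); rewrite ge_min lexx.
by apply: B2; apply: (lt_le_trans ut); rewrite ge_min lexx orbT.
Qed.

Lemma increasing_left_limit (tau : R -> R) t : (forall s u, s < u -> tau s < tau u) ->
  exists L, [/\ forall u, u < t -> tau u < L, L <= tau t &
    forall e, 0 < e -> exists2 d, 0 < d & forall u, t - d < u < t -> L - e < tau u].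
Proof.
move=> tauM; pose S : set R := [set tau u | u in [set u | u < t]].
have S0 : S !=set0 by exists (tau (t - 1)), (t - 1) => //=; lra.
have bS : ubound S (tau t) by move=> _ [u /= ut <-]; exact/ltW/tauM.
have supS : has_sup S by split=> //; exists (tau t).
exists (sup S); split=> [u ut||e e0]; last 2 first.
- exact: ge_sup.
- have [_ [u0 /= u0t <-] u0e] := sup_adherent e0 supS.
  exists (t - u0); first lra.
  move=> u uI; apply: (lt_trans u0e); apply: tauM; lra.
have : tau ((u + t) / 2) <= sup S.
  by apply: ub_le_sup; [case: supS|exists ((u + t) / 2) => //=; lra].
have : tau u < tau ((u + t) / 2) by apply: tauM; lra.
lra.
Qed.

Lemma increasing_right_limit (tau : R -> R) t : (forall s u, s < u -> tau s < tau u) ->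
  exists M, [/\ forall u, t < u -> M < tau u, tau t <= M &
    forall e, 0 < e -> exists2 d, 0 < d & forall u, t < u < t + d -> tau u < M + e].
Proof.
move=> tauM; have [|L [L1 L2 L3]] := @increasing_left_limit (fun u => - tau (- u)) (- t).
  by move=> s u su; rewrite ltrN2; apply: tauM; lra.
rewrite opprK in L2; exists (- L); split=> [u tu||e e0].
- by have := L1 (- u) ltac:(lra); rewrite opprK; lra.
- lra.
- have [d d0 dP] := L3 e e0; exists d => // u uI.
  by have := dP (- u) ltac:(lra); rewrite opprK; lra.
Qed.

(* An increasing time change along an orbit can only jump by periods of the
   orbit, and removing the jumps at one time t makes it continuous there. *)
Lemma clock_continuous_at (Y : topologicalType) (psi : R -> Y -> Y) (c : R -> Y)
    (tau : R -> R) (y : Y) (t : R) :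
  hausdorff_space Y -> is_flow psi -> continuous c ->
  (forall s u, s < u -> tau s < tau u) -> (forall u, c u = psi (tau u) y) ->
  exists tau' : R -> R, [/\ forall s u, s < u -> tau' s < tau' u, tau' t = tau t,
    forall u, c u = psi (tau' u) y &
    forall e, 0 < e -> exists2 d, 0 < d &
      forall u, t - d < u < t + d -> tau t - e < tau' u < tau t + e].
Proof.
move=> hY psi_flow cc tauM cE; have [_ [psi0 psiD]] := psi_flow.
have [L [L1 L2 L3]] := increasing_left_limit t tauM.
have [M [M1 M2 M3]] := increasing_right_limit t tauM.
have pc := @flow_line_continuous _ _ psi psi_flow y.
have psiL : psi L y = psi (tau t) y.
  rewrite -cE; apply: (value_at_jump hY cc pc cE) => e e0.
  have [d d0 dP] := L3 e e0; pose r := Num.min d e.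
  have [rd re] : r <= d /\ r <= e by rewrite !ge_min !lexx orbT.
  have r0 : 0 < r by rewrite lt_min d0.
  exists (t - r / 2); split; first by rewrite ltr_norml; lra.
  have := dP (t - r / 2) ltac:(lra); have := L1 (t - r / 2) ltac:(lra).
  by rewrite ltr_norml; lra.
have psiM : psi M y = psi (tau t) y.
  rewrite -cE; apply: (value_at_jump hY cc pc cE) => e e0.
  have [d d0 dP] := M3 e e0; pose r := Num.min d e.
  have [rd re] : r <= d /\ r <= e by rewrite !ge_min !lexx orbT.
  have r0 : 0 < r by rewrite lt_min d0.
  exists (t + r / 2); split; first by rewrite ltr_norml; lra.
  have := dP (t + r / 2) ltac:(lra); have := M1 (t + r / 2) ltac:(lra).
  by rewrite ltr_norml; lra.
have per a : psi a y = psi (tau t) y -> psi (tau t - a) y = y.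
  by move=> ay; rewrite addrC psiD -ay -psiD addNr psi0.
(* Both one-sided limits are moved to [tau t]. The shifts are periods of [y] by [per], so the new
   time change still describes [c]. *)
exists (fun u => if u < t then tau u + (tau t - L) else
  if t < u then tau u + (tau t - M) else tau t); split.
- move=> s u su; case: (ltgtP s t) => st; case: (ltgtP u t) => ut;
    have := tauM s u su; rewrite ?st ?ut.
  + lra.
  + by have := L1 s st; have := M1 u ut; lra.
  + by have := L1 s st; lra.
  + lra.
  + lra.
  + lra.
  + lra.
  + by have := M1 u ut; lra.
  + lra.
- by rewrite ltxx.
- move=> u; case: (ltgtP u t) => [ut|ut|->//].
  + by rewrite psiD per.
  + by rewrite psiD per.
- move=> e e0; have [d1 d10 d1P] := L3 e e0; have [d2 d20 d2P] := M3 e e0.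
  pose r := Num.min d1 d2.
  have [rd1 rd2] : r <= d1 /\ r <= d2 by rewrite !ge_min !lexx orbT.
  exists r; first by rewrite lt_min d10.
  move=> u uI; case: (ltgtP u t) => ut; last lra.
  + by have := d1P u ltac:(lra); have := L1 u ut; lra.
  + by have := d2P u ltac:(lra); have := M1 u ut; lra.
Qed.

Variable n : nat.

(** The condition is local at each time [t], so a time change continuous at that one [t] is enough;
    it may be chosen anew for every [t]. *)
Lemma along_orbits_transport (X Y : topologicalType) (phi : R -> X -> X)
    (psi : R -> Y -> Y) (h : X -> Y) (q : Y -> plane) :
  hausdorff_space Y -> is_flow phi -> is_flow psi -> continuous h ->
  (forall x, exists tau : R -> R, (forall s t, s < t -> tau s < tau t) /\
     forall t, h (phi t x) = psi (tau t) (h x)) ->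
  along_orbits n psi q -> along_orbits n phi (q \o h).
Proof.
move=> hY phi_flow psi_flow hc ht qa x t; have [tau0 [tau0M tau0E]] := ht x.
have cc : continuous (fun u => h (phi u x)).
  move=> u; apply: (@continuous_comp _ _ _ (fun u => phi u x) h); last exact: hc.
  exact: flow_line_continuous phi_flow _ _.
have [tau [tauM taut tauE tauC]] :=
  clock_continuous_at t hY psi_flow cc tau0M tau0E.
rewrite -taut in tauC.
have [[e [e0 einj]] [e' [j [k [th1 [th2 [e'0 [I1 [m1 [I2 m2]]]]]]]]]] := qa (h x) (tau t).
split.
  have [d d0 dP] := tauC e e0; exists d; split=> // s1 s2 s1I s2I /=.
  rewrite !tauE => /(einj _ _ (dP _ s1I) (dP _ s2I)) ss.
  case: (ltgtP s1 s2) => // /tauM; rewrite ss ltxx//.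
have [d d0 dP] := tauC e' e'0.
have le u v : u <= v -> tau u <= tau v.
  by rewrite le_eqVlt => /orP[/eqP -> //|/tauM/ltW].
exists d, j, k, (th1 \o tau), (th2 \o tau); split=> //; split; last split; last split.
- move=> u uI /=; rewrite tauE; apply: I1.
  by have := dP u ltac:(lra); have := le u t ltac:(lra); lra.
- move=> u1 u2 h1 h2 h3 /=; apply: m1; last (by apply: le); last exact: tauM.
  by have := dP u1 ltac:(lra); lra.
- move=> u uI /=; rewrite tauE; apply: I2.
  by have := dP u ltac:(lra); have := le t u ltac:(lra); lra.
- move=> u1 u2 h1 h2 h3 /=; apply: m2; [exact: le|exact: tauM|].
  by have := dP u2 ltac:(lra); lra.
Qed.

(** The projections become [q i \o h], the base point [g y0], and the bonding maps stay the same. *)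
Lemma admissible_expansion_transport (m : nat) (sigma : 'I_m -> endo n)
    (X Y : topologicalType) (phi : R -> X -> X) (psi : R -> Y -> Y) sq :
  is_flow phi -> is_flow psi -> flow_equivalent phi psi ->
  admissible_expansion sigma psi sq -> admissible_expansion sigma phi sq.
Proof.
move=> phi_flow psi_flow [h [g [hg [gh [hc [gc [_ ht]]]]]]].
move=> [y0 [f [q [fm [qc [qW [qS [qa [q0 [qf [qinj [qth qtop]]]]]]]]]]]].
have hY : hausdorff_space Y.
  exact: separating_hausdorff (@plane_hausdorff R) qc qinj.
exists (g y0), f, (fun i => q i \o h); split=> //; split.
  by move=> i x; apply: (@continuous_comp _ _ _ h (q i)); [exact: hc|exact: qc].
split; first by move=> i x; exact: qW.
split; first by move=> i z /(qS i)[y <-]; exists (g y); rewrite /= gh.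
split; first by move=> i; exact: along_orbits_transport (qa i).
split; first by move=> i; rewrite /= gh.
split; first by move=> i x; exact: qf.
split; first by move=> x x' xx; apply: (can_inj hg); exact: qinj.
split; first by move=> y yW yf; have [z zy] := qth y yW yf; exists (g z) => i /=; rewrite gh.
move=> U oU x Ux; have oV : open (g @^-1` U) by apply: open_comp => // z _; exact: gc.
have [|N [V [Vo [VN VU]]]] := qtop _ oV (h x); first by rewrite /preimage /= hg.
exists N, V; split=> //; split=> // x' Vx'.
by have := VU (h x') Vx'; rewrite /preimage /= hg.
Qed.

Lemma compatible_inv (gm : 'I_n -> R -> plane) F F' G G' H H' :
  rescaling G -> rescaling H' ->
  (forall a x, 0 <= x <= 1 -> H a (G a x) = x) ->
  (forall a x, 0 <= x <= 1 -> G' a (H' a x) = x) ->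
  compatible gm F F' G G' -> compatible gm F' F H H'.
Proof.
move=> GB HB HG GH C a u u01; have [HI _ _] := HB a.
have [b [x [x01 Fx F'x]]] := C a (H' a u) (HI u u01).
exists b, (G b x); split; first by have [GI _ _] := GB b; exact: GI.
  by rewrite -F'x GH.
by rewrite HG.
Qed.

(** The rescalings [G] and their inverses [H] induce limit maps in both directions, which are
    mutually inverse at every level. *)
Lemma expansions_flow_equivalent (X Y : topologicalType) (phi : R -> X -> X)
    (psi : R -> Y -> Y) (w : nat -> endo n) f f' p q :
  is_flow phi -> is_flow psi -> (forall i, proper_endo (w i)) ->
  expansion phi w f p -> expansion psi w f' q -> flow_equivalent phi psi.
Proof.
move=> phi_flow psi_flow wp EX EY.
have wf i a : exists tt, pieces (@gam R n) (w i a) (f i) a tt.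
  by have [_ [_ [_ [_]]]] := exp_map EX i; apply.
have wf' i a : exists tt, pieces (@gam R n) (w i a) (f' i) a tt.
  by have [_ [_ [_ [_]]]] := exp_map EY i; apply.
have [G [GB GC]] := rescalings_exist wf wf'.
have /choice[H HP] i := rescaling_inv (GB i).
have HB i : rescaling (H i) by have [] := HP i.
have HG i a x : 0 <= x <= 1 -> H i a (G i a x) = x by have [_ + _] := HP i; apply.
have GH i a x : 0 <= x <= 1 -> G i a (H i a x) = x by have [_ _] := HP i; apply.
have HC i : compatible (@gam R n) (f' i) (f i) (H i) (H i.+1).
  exact: compatible_inv (GB i) (HB i.+1) (HG i) (GH i.+1) (GC i).
have [h [hc hq]] := limit_map EX EY GB GC.
have [g [gc gp]] := limit_map EY EX HB HC.
have gB := @gam_bouquet R n.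
have hg : cancel h g.
  move=> x; apply: (exp_inj EX) => i; rewrite gp hq.
  exact: (rescale_cancel gB (GB i) (HB i) (HG i) (expansion_in_bouquet i x EX)).
have gh : cancel g h.
  move=> y; apply: (exp_inj EY) => i; rewrite hq gp.
  exact: (rescale_cancel gB (HB i) (GB i) (GH i) (expansion_in_bouquet i y EY)).
have orb x := limit_map_orbit EX EY GB x hc hq phi_flow psi_flow wp.
have orb' y := limit_map_orbit EY EX HB y gc gp psi_flow phi_flow wp.
exists h, g; do 4!split=> //; split; last first.
  by move=> x; exact: orb.
move=> x; apply/seteqP; split=> y.
  move=> [_ [t ->] <-]; have [tau [_ ->]] := orb x.
  by exists (tau t).
(* The whole orbit of [h x] is hit because [g] in turn carries it into the orbit of [x]. *)
move=> [t ->]; have [tau [_ tauE]] := orb' (h x).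
by exists (phi (tau t) x); [exists (tau t)|rewrite -[X in phi _ X]hg -tauE gh].
Qed.

End Transport.

Theorem theorem8p8 (R : realType) (n m : nat) (sigma : 'I_m -> endo n) :
  (forall i, positive_endo (sigma i)) ->
  (forall i, proper_endo (sigma i)) ->
  (forall i, primitive_endo (sigma i)) ->
  freely_generate (fun i => abel_mx (sigma i)) ->
  forall (X Y : topologicalType) (phi : R -> X -> X) (psi : R -> Y -> Y),
    flow_space phi -> flow_space psi ->
    in_S sigma phi -> in_S sigma psi ->
    (flow_equivalent phi psi <->
     exists sx sy : nat -> 'I_m,
       admissible_expansion sigma phi sx /\ admissible_expansion sigma psi sy /\
       tail_equiv (fun i => sigma (sx i)) (fun i => sigma (sy i))).
Proof.
move=> _ sigma_proper _ _ X Y phi psi [_ [_ [_ [phi_flow _]]]] [_ [_ [_ [psi_flow _]]]] _ [sq Esq].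
split=> [eqv|[sx [sy [/admissible_expansionP[f [p EX]] [/admissible_expansionP[f' [q EY]] [k [l kl]]]]]]].
  (* The expansion of [Y] is pulled back to [X], so one sequence serves both. *)
  exists sq, sq; split; first exact: admissible_expansion_transport eqv Esq.
  by split=> //; exists 0%N, 0%N.
(* Tail equivalence is stated for the endomorphisms themselves, so after the shifts both expansions
   have literally the same sequence of words. *)
have := expansion_shift k EX; rewrite (funext kl) => EXk.
by apply: expansions_flow_equivalent EXk (expansion_shift l EY).
Qed.
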